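(* Let $n\ge 1$. Every proper nontrivial $M$-ideal in $H^\infty(\mathbb{D}^n)$ is an analytic prime.
   Context: $\mathbb{D}$ is the open unit disc in $\mathbb{C}$, $\mathbb{T}$ the unit circle, and $H^\infty(\mathbb{D}^n)$ is the Banach algebra of bounded holomorphic functions on $\mathbb{D}^n$ with $\|f\|=\sup_{z\in\mathbb{D}^n}|f(z)|$. For $f\in H^\infty(\mathbb{D}^n)$, $\tilde f(z)=\lim_{r\to1^-}f(rz)$ denotes the radial limit function, defined for almost every $z\in\mathbb{T}^n$ (normalized Lebesgue measure). $M$-ideal: a closed subspace $C$ of a complex Banach space $X$ is an $M$-ideal in $X$ if there is a bounded linear projection $P:X^*\to X^*$ ($P^2=P$) with $\operatorname{ran}P=C^\perp=\{x^*\in X^*: x^*|_C\equiv0\}$ and $\|Px^*\|+\|(I-P)x^*\|=\|x^*\|$ for all $x^*\in X^*$. ''Proper'' means $\neq H^\infty(\mathbb{D}^n)$ and ''nontrivial'' means $\neq\{0\}$. Analytic prime: a proper nontrivial closed subspace $J$ of $H^\infty(\mathbb{D}^n)$ is an analytic prime if, whenever $f,g\in H^\infty(\mathbb{D}^n)$ satisfy $fg\in J$ and there is $\delta>0$ with $|\tilde f(z)|>\delta$ for almost every $z\in\mathbb{T}^n$, then $g\in J$. *)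

(* Defs.v *)
From HB Require Import structures.
From mathcomp Require Import all_boot all_order all_algebra.
From mathcomp Require Import complex.
From mathcomp Require Import all_classical all_reals all_analysis.

Set Implicit Arguments.
Unset Strict Implicit.
Unset Printing Implicit Defensive.

Import Order.TTheory GRing.Theory Num.Theory.
Import numFieldNormedType.Exports.

Local Open Scope classical_set_scope.
Local Open Scope ring_scope.
Local Open Scope complex_scope.

(* The library puts the norm topology on abstract [numFieldType]s only; these
   copies put it on the concrete field [R[i]], regarded as a normed module over
   itself. The norm [`|z|] is the modulus, as a (real) element of [R[i]]. *)
HB.instance Definition _ (R : realType) := GRing.ComAlgebra.copy R[i] R[i]^o.
HB.instance Definition _ (R : realType) := Vector.copy R[i] R[i]^o.
HB.instance Definition _ (R : realType) := NormedModule.copy R[i] R[i]^o.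

Section SupNorm.
Context {R : realType} {T : Type}.
Implicit Types (A : set T) (f g : T -> R[i]).

Definition sup_norm A f : R := sup [set complex.Re `|f x| | x in A].

Lemma bounded_onP A f : [bounded f x | x in A] <->
  exists M : R, forall x, A x -> `|f x| <= M%:C.
Proof.
split=> [/pinfty_ex_gt0[M _ /= HM]|[M HM]].
  exists (complex.Re M) => x /HM; rewrite !lecE /= => /andP[/eqP e h].
  by rewrite eqxx.
exists M%:C; split; first by rewrite realE !lecE /= !eqxx /= le_total.
by move=> y /ltW My x /HM /le_trans; apply.
Qed.

Lemma ReK_norm (z : R[i]) : (complex.Re `|z|)%:C = `|z|.
Proof. by []. Qed.

Lemma sup_norm_ub A f x : [bounded f y | y in A] -> A x ->
  `|f x| <= (sup_norm A f)%:C.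
Proof.
move=> /bounded_onP[M HM] Ax; rewrite -ReK_norm lecR; apply: ub_le_sup.
  by exists M => _ [y Ay <-]; rewrite -lecR ReK_norm; exact: HM.
by exists x.
Qed.

Lemma sup_norm_le A f (M : R) : A !=set0 ->
  (forall x, A x -> `|f x| <= M%:C) -> sup_norm A f <= M.
Proof.
move=> [x0 Ax0] HM; apply: ge_sup; first by exists (complex.Re `|f x0|), x0.
by move=> _ [y Ay <-]; rewrite -lecR ReK_norm; exact: HM.
Qed.

Lemma bounded_onD A f g : [bounded f x | x in A] -> [bounded g x | x in A] ->
  [bounded (f + g) x | x in A].
Proof.
move=> /bounded_onP[M HM] /bounded_onP[N HN]; apply/bounded_onP; exists (M + N).
move=> x Ax; rewrite rmorphD /=; apply: le_trans (ler_normD _ _) _.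
by rewrite lerD ?HM ?HN.
Qed.

Lemma bounded_onM A f g : [bounded f x | x in A] -> [bounded g x | x in A] ->
  [bounded (f * g) x | x in A].
Proof.
move=> /bounded_onP[M HM] /bounded_onP[N HN]; apply/bounded_onP; exists (M * N).
by move=> x Ax; rewrite rmorphM /= normrM ler_pM ?HM ?HN.
Qed.

Lemma bounded_on_cst A (a : R[i]) : [bounded (cst a : T -> R[i]) x | x in A].
Proof. by apply/bounded_onP; exists (complex.Re `|a|). Qed.

Lemma bounded_onZ A f (a : R[i]) : [bounded f x | x in A] ->
  [bounded (a *: f) x | x in A].
Proof. by move=> bf; exact: bounded_onM (bounded_on_cst A a) bf. Qed.

Lemma sup_normD A f g : A !=set0 ->
  [bounded f x | x in A] -> [bounded g x | x in A] ->
  sup_norm A (f + g) <= sup_norm A f + sup_norm A g.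
Proof.
move=> A0 bf bg; apply: sup_norm_le => // x Ax.
rewrite rmorphD /=; apply: le_trans (ler_normD _ _) _.
by rewrite lerD ?sup_norm_ub.
Qed.

Lemma sup_norm_ge0 A f : A !=set0 -> [bounded f x | x in A] ->
  0 <= sup_norm A f.
Proof.
move=> [x Ax] bf; rewrite -lecR; apply: le_trans (sup_norm_ub bf Ax).
exact: normr_ge0.
Qed.

Lemma sup_normZ A f (a : R[i]) : A !=set0 -> [bounded f x | x in A] ->
  (sup_norm A (a *: f))%:C = `|a| * (sup_norm A f)%:C.
Proof.
move=> A0 bf; rewrite -ReK_norm -rmorphM; congr _%:C; apply/eqP.
have le1 (b : R[i]) (h : T -> R[i]) : [bounded h x | x in A] ->
    sup_norm A (b *: h) <= complex.Re `|b| * sup_norm A h.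
  move=> bh; apply: sup_norm_le => // x Ax.
  by rewrite rmorphM /= ReK_norm normrM ler_wpM2l ?sup_norm_ub.
rewrite eq_le le1 // andTb; have [->|a0] := eqVneq a 0.
  by rewrite normr0 mul0r sup_norm_ge0 //; exact: bounded_onZ.
have ai0 : 0 < complex.Re `|a| by rewrite -ltcR ReK_norm normr_gt0.
rewrite -ler_pdivlMl // mulrC.
have := le1 a^-1 _ (bounded_onZ a bf); rewrite scalerA mulVf // scale1r.
suff -> : complex.Re `|a^-1| = (complex.Re `|a|)^-1 by rewrite mulrC.
by apply: complexI; rewrite ReK_norm normfV fmorphV.
Qed.

Lemma sup_norm_eq0 A f x : [bounded f y | y in A] -> sup_norm A f = 0 ->
  A x -> f x = 0.
Proof.
move=> bf f0 Ax; apply/eqP; rewrite -normr_le0.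
by have := sup_norm_ub bf Ax; rewrite f0.
Qed.

End SupNorm.

Lemma differentiable_near (K : numFieldType) (V W : normedModType K)
  (f g : V -> W) (x : V) : (\forall y \near x, f y = g y) ->
  differentiable f x -> differentiable g x.
Proof.
move=> fg /diff_locallyP[cdf dff]; have fgx : f x = g x := nbhs_singleton fg.
have dgf : g \o shift x = cst (g x) + 'd f x +o_ 0 id.
  apply/eqaddoP => e e0; move/eqaddoP: dff => /(_ e e0).
  apply: filter_app; move: fg; rewrite (near_shift 0) subr0 => fg.
  near=> h; rewrite !fctE /= -fgx; have /= := near fg h.
  by move=> -> //.
by apply/diff_locallyP; rewrite (diff_unique cdf dgf).
Unshelve. all: by end_near. Qed.

Section HardySpace.
Context {R : realType} {n : nat}.
Local Notation C := R[i].
Implicit Types f g : 'rV[C]_n -> C.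

Definition polydisc : set 'rV[C]_n := [set z | forall j, `|z 0 j| < 1].

Definition holomorphic_on (U : set 'rV[C]_n) f :=
  forall z, U z -> differentiable f z.

(* A function on the polydisc is represented by its extension by [0] to the
   whole space, so that equality in [Hinf] is equality on the polydisc. *)
Definition Hinf_pred : {pred 'rV[C]_n -> C} := fun f =>
  `[< [/\ holomorphic_on polydisc f, [bounded f z | z in polydisc]
        & forall z, ~ polydisc z -> f z = 0] >].

Lemma polydisc_open : open polydisc.
Proof.
rewrite openE => z zD; rewrite /interior.
suff : nbhs z [set w : 'rV[C]_n | forall j : 'I_n, `|w 0 j| < 1] by [].
apply: (@filter_forall _ _ (fun (j : 'I_n) (w : 'rV[C]_n) => `|w 0 j| < 1) (nbhs z)) => j.
apply: (@coord_continuous C 1 n 0 j z [set w | `|w| < 1]).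
apply/nbhs_ballP; exists (1 - `|z 0 j|); first by rewrite /= subr_gt0.
move=> w; rewrite -ball_normE /= distrC => zw.
by rewrite -(subrK (z 0 j) w) (le_lt_trans (ler_normD _ _)) // -ltrBrDr.
Qed.

Lemma polydisc0 : polydisc 0.
Proof. by move=> j; rewrite mxE normr0. Qed.

Lemma polydisc_neq0 : polydisc !=set0. Proof. by exists 0; exact: polydisc0. Qed.

Lemma Hinf_submod_closed : submod_closed Hinf_pred.
Proof.
split.
  apply/asboolP; split; [|exact: (bounded_on_cst polydisc 0)|by []].
  by move=> z zD; exact: (differentiable_cst (0 : C)).
move=> a f g /asboolP[hf bf f0] /asboolP[hg bg g0]; apply/asboolP; split.
- move=> z zD; apply: differentiableD; last exact: hg.
  by apply: differentiableZ; exact: hf.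
- by apply: bounded_onD => //; exact: bounded_onZ.
- by move=> z zD; rewrite !fctE f0 // g0 // scaler0 addr0.
Qed.

HB.instance Definition _ := GRing.isSubmodClosed.Build C ('rV[C]_n -> C)
  Hinf_pred Hinf_submod_closed.

End HardySpace.

Record Hinf (R : realType) (n : nat) := MkHinf {
  Hinf_val :> 'rV[R[i]]_n -> R[i];
  Hinf_valP : Hinf_val \in Hinf_pred }.

HB.instance Definition _ R n := [isSub for @Hinf_val R n].
HB.instance Definition _ R n := [Choice of Hinf R n by <:].
HB.instance Definition _ R n := [SubChoice_isSubLmodule of Hinf R n by <:].

Section HardyAlgebra.
Context {R : realType} {n : nat}.
Local Notation C := R[i].
Local Notation H := (Hinf R n).
Implicit Types f g h : H.

Lemma Hinf_holomorphic f : holomorphic_on polydisc f.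
Proof. by have /asboolP[] := Hinf_valP f. Qed.

Lemma Hinf_bounded f : [bounded f z | z in polydisc].
Proof. by have /asboolP[] := Hinf_valP f. Qed.

Lemma Hinf_out f z : ~ polydisc z -> f z = 0.
Proof. by have /asboolP[_ _] := Hinf_valP f; exact. Qed.

Definition Hinf_norm f : C := (sup_norm polydisc f)%:C.

Lemma Hinf_normD f g : Hinf_norm (f + g) <= Hinf_norm f + Hinf_norm g.
Proof.
rewrite /Hinf_norm -rmorphD lecR.
by apply: sup_normD; [exact: polydisc_neq0|exact: Hinf_bounded..].
Qed.

Lemma Hinf_normZ (a : C) f : Hinf_norm (a *: f) = `|a| * Hinf_norm f.
Proof.
by apply: sup_normZ; [exact: polydisc_neq0|exact: Hinf_bounded].
Qed.

Lemma Hinf_norm0_eq0 f : Hinf_norm f = 0 -> f = 0.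
Proof.
move=> /complexI f0; apply/val_inj/funext => z /=.
have [zD|/Hinf_out -> //] := pselect (polydisc z).
exact: sup_norm_eq0 (Hinf_bounded f) f0 zD.
Qed.

HB.instance Definition _ := @Lmodule_isNormed.Build C H Hinf_norm
  Hinf_normD Hinf_normZ Hinf_norm0_eq0.

Lemma Hinf_one_subproof :
  (\1_polydisc : 'rV[C]_n -> C) \in @Hinf_pred R n.
Proof.
apply/asboolP; split.
- move=> z zD; apply: (@differentiable_near _ _ _ (cst 1 : 'rV[C]_n -> C) _ z).
    apply: filterS (open_nbhs_nbhs (conj polydisc_open zD)) => w wD.
    by rewrite indicE mem_set.
  exact: differentiable_cst.
- apply/bounded_onP; exists 1 => z zD.
  by rewrite indicE mem_set // normr1.
- by move=> z zD; rewrite indicE memNset.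
Qed.

Lemma Hinf_mul_subproof f g : (f : 'rV[C]_n -> C) * g \in Hinf_pred.
Proof.
apply/asboolP; split.
- by move=> z zD; apply: differentiableM; exact: Hinf_holomorphic.
- by apply: bounded_onM; exact: Hinf_bounded.
- by move=> z zD; rewrite !fctE Hinf_out // mul0r.
Qed.

Definition Hinf_one : H := MkHinf Hinf_one_subproof.
Definition Hinf_mul f g : H := MkHinf (Hinf_mul_subproof f g).

Lemma Hinf_mulA : associative Hinf_mul.
Proof. by move=> f g h; apply/val_inj; rewrite /= mulrA. Qed.

Lemma Hinf_mulC : commutative Hinf_mul.
Proof. by move=> f g; apply/val_inj; rewrite /= mulrC. Qed.

Lemma Hinf_mul1 : left_id Hinf_one Hinf_mul.
Proof.
move=> f; apply/val_inj/funext => z /=; rewrite !fctE indicE.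
have [zD|zD] := pselect (polydisc z); first by rewrite mem_set // mul1r.
by rewrite Hinf_out // mulr0.
Qed.

Lemma Hinf_mulDl : left_distributive Hinf_mul +%R.
Proof. by move=> f g h; apply/val_inj; rewrite /= mulrDl. Qed.

Lemma Hinf_one_neq0 : Hinf_one != 0.
Proof.
apply/eqP => /(congr1 (fun f : H => f 0)) /=.
rewrite indicE mem_set; last exact: polydisc0.
by move=> /eqP; rewrite oner_eq0.
Qed.

HB.instance Definition _ := GRing.Zmodule_isComNzRing.Build H
  Hinf_mulA Hinf_mulC Hinf_mul1 Hinf_mulDl Hinf_one_neq0.

Lemma Hinf_scalerAl (a : C) f g : a *: (f * g) = (a *: f) * g.
Proof. by apply/val_inj/funext => z; exact: mulrA. Qed.

HB.instance Definition _ := GRing.Lmodule_isLalgebra.Build C H Hinf_scalerAl.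

End HardyAlgebra.

Section Dual.
Context {R : realType} {X : normedModType R[i]}.
Local Notation C := R[i].

Definition dual_pred : {pred X -> C} := fun phi =>
  `[< linear phi /\ continuous phi >].

Lemma dual_submod_closed : submod_closed dual_pred.
Proof.
split.
  apply/asboolP; split; last by move=> x; exact: cst_continuous.
  move=> a x y; rewrite -[LHS]/(0 : C) -[RHS]/(a *: (0 : C) + 0).
  by rewrite scaler0 addr0.
move=> a f g /asboolP[lf cf] /asboolP[lg cg]; apply/asboolP; split.
  move=> b x y; rewrite -[LHS]/(a *: f (b *: x + y) + g (b *: x + y)).
  rewrite -[RHS]/(b *: (a *: f x + g x) + (a *: f y + g y)) lf lg.
  by rewrite !scalerDr !scalerA (mulrC a b) addrACA.
move=> x; apply: continuousD; last exact: cg.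
exact: continuousZl_tmp (cf x).
Qed.

HB.instance Definition _ := GRing.isSubmodClosed.Build C (X -> C)
  dual_pred dual_submod_closed.

End Dual.

Record dual (R : realType) (X : normedModType R[i]) := MkDual {
  dual_val :> X -> R[i];
  dual_valP : dual_val \in dual_pred }.

HB.instance Definition _ R X := [isSub for @dual_val R X].
HB.instance Definition _ R X := [Choice of @dual R X by <:].
HB.instance Definition _ R X := [SubChoice_isSubLmodule of @dual R X by <:].

Section DualNorm.
Context {R : realType} {X : normedModType R[i]}.
Local Notation C := R[i].
Local Notation unit_ball := [set x : X | `|x| <= 1].
Implicit Types phi psi : dual X.

Lemma dual_linear phi : linear phi.
Proof. by have /asboolP[] := dual_valP phi. Qed.

Lemma dual_continuous phi : continuous phi.
Proof. by have /asboolP[] := dual_valP phi. Qed.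

HB.instance Definition _ phi :=
  GRing.isLinear.Build C X C *:%R phi (dual_linear phi).

Lemma unit_ball_neq0 : unit_ball !=set0.
Proof. by exists 0; rewrite /= normr0. Qed.

Lemma dual_bounded phi : [bounded phi x | x in unit_ball].
Proof.
have /continuous_linear_bounded bf : {for 0, continuous phi}.
  exact: dual_continuous.
have /bounded_funP/(_ 1)[M HM] := bf 0.
apply/bounded_onP; exists (complex.Re M) => x /HM.
by rewrite !lecE /= => /andP[/eqP <- ->]; rewrite eqxx.
Qed.

Definition dual_norm phi : C := (sup_norm unit_ball phi)%:C.

Lemma dual_normD phi psi : dual_norm (phi + psi) <= dual_norm phi + dual_norm psi.
Proof.
rewrite /dual_norm -rmorphD lecR.
by apply: sup_normD; [exact: unit_ball_neq0|exact: dual_bounded..].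
Qed.

Lemma dual_normZ (a : C) phi : dual_norm (a *: phi) = `|a| * dual_norm phi.
Proof.
by apply: sup_normZ; [exact: unit_ball_neq0|exact: dual_bounded].
Qed.

Lemma dual_norm0_eq0 phi : dual_norm phi = 0 -> phi = 0.
Proof.
move=> /complexI f0; apply/val_inj/funext => x /=.
have [->|x0] := eqVneq x 0; first by rewrite linear0.
have nx0 : `|x| != 0 by rewrite normr_eq0.
have : phi (`|x|^-1 *: x) = 0.
  apply: sup_norm_eq0 (dual_bounded phi) f0 _.
  by rewrite /= normrZ normfV normr_id mulVf.
by rewrite linearZ /= => /eqP; rewrite scaler_eq0 invr_eq0 (negPf nx0) => /eqP.
Qed.

HB.instance Definition _ := @Lmodule_isNormed.Build C (dual X) dual_norm
  dual_normD dual_normZ dual_norm0_eq0.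

End DualNorm.

Section MIdeal.
Context {R : realType} {X : normedModType R[i]}.
Implicit Type J : set X.

Definition closed_subspace J :=
  [/\ closed J, J 0 & forall (a : R[i]) x y, J x -> J y -> J (a *: x + y)].

Definition annihilator J : set (dual X) :=
  [set phi | forall x, J x -> phi x = 0].

Definition M_ideal J := closed_subspace J /\
  exists P : {linear dual X -> dual X},
    [/\ exists M : R, forall phi, `|P phi| <= M%:C * `|phi|,
        forall phi, P (P phi) = P phi,
        range P = annihilator J &
        forall phi, `|P phi| + `|phi - P phi| = `|phi|].

End MIdeal.

Section TupleProbability.
Context {d : measure_display} {T : measurableType d} {R : realType}.
Variable P : probability T R.

Definition tuple_cons n (x : T * n.-tuple T) : n.+1.-tuple T :=
  [tuple of x.1 :: x.2].

Lemma measurable_tuple_cons n : measurable_fun setT (@tuple_cons n).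
Proof. exact: measurable_cons. Qed.

HB.instance Definition _ n := isMeasurableFun.Build _ _ _ _ (@tuple_cons n)
  (@measurable_tuple_cons n).

(* The [n]-fold product measure of [P]. *)
Fixpoint tuple_prob n : probability (n.-tuple T) R :=
  if n is m.+1
  then distribution (P \x tuple_prob m)%E (@tuple_cons m)
  else \d_[tuple].

End TupleProbability.

Section AnalyticPrime.
Context {R : realType} {n : nat}.
Local Notation C := R[i].

Definition torus_point (t : n.-tuple R) : 'rV[C]_n :=
  \row_j (cos (tnth t j) +i* sin (tnth t j)).

Lemma pi2_gt0 : 0 < 2 * pi :> R.
Proof. by rewrite mulr_gt0 ?pi_gt0. Qed.

(* Normalized Lebesgue measure on the torus is the image of the uniform
   probability on the cube [0, 2pi]^n of angles. *)
Definition ae_torus (Q : 'rV[C]_n -> Prop) : Prop :=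
  {ae tuple_prob (uniform_prob pi2_gt0) n, forall t, Q (torus_point t)}.

Definition radial (f : Hinf R n) (z : 'rV[C]_n) (r : R) : C := f (r%:C *: z).

Definition radial_limit (f : Hinf R n) (z : 'rV[C]_n) : C :=
  lim (radial f z r @[r --> 1^'-]).

Definition analytic_prime (J : set (Hinf R n)) :=
  [/\ closed_subspace J, J <> setT, J <> [set 0] &
    forall f g : Hinf R n, J (f * g) ->
      (exists2 delta : R, 0 < delta &
        ae_torus (fun z => cvg (radial f z r @[r --> 1^'-]) /\
                           delta%:C < `|radial_limit f z|)) ->
      J g].

End AnalyticPrime.

(* Main.v *)
Require Import Defs.
From HB Require Import structures.
From mathcomp Require Import all_boot all_order all_algebra.
From mathcomp Require Import complex ring lra.
From mathcomp Require Import all_classical all_reals all_analysis.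
From mathcomp Require Import measurable_realfun.

(** Write A for the algebra H^oo(D^n), let J be an M-ideal with L-projection P
    onto its annihilator, and let f g belong to J with |f| > delta almost
    everywhere on the torus.  If g is not in J, some functional phi annihilates
    J but not g ([annihilator_separates]).

    Let S be the set of points of D^n where |f| >= delta.  It is norming for A:
    a bound |h| <= M on S holds on all of D^n ([boundary_maximum]).  Hence A
    embeds isometrically in the algebra of bounded functions on S, in which f is
    invertible, and phi has an extension mu to that algebra with the same norm
    ([hahn_banach]).  For a function u on S with values in [0, 1], the
    functionals h |-> mu (u h) and h |-> mu ((1 - u) h) on A have norms adding
    up to at most |phi|, because |u h1 + (1 - u) h2| <= 1 when |h1|, |h2| <= 1.
    A functional in the range of an L-projection can be split in this way only
    inside the range ([M_ideal_summand]), so mu (u h) = 0 for all h in J.  By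
    linearity this remains true for every bounded u ([M_ideal_cancel]), and
    u = 1/f gives phi g = mu (1/f * (f g)) = 0, a contradiction.

    The norming property rests on an estimate
      |F z| <= K * (mean of |F| over the torus)
    for bounded continuous F that are holomorphic in each variable of modulus
    less than 1, where K depends on z only ([polydisc_mean]).  It is applied to
    the powers of the dilates w |-> h (r w): almost every radius ends in S, so as
    r tends to 1 dominated convergence gives |h z|^k <= K M^k, and k-th roots
    remove K.

    The estimate is iterated from its one-variable case ([disc_mean]) by Tonelli.
    In one variable it follows from the vanishing of the mean over the unit
    circle of w (F w - F z) / (w - z), a function that is 0 at w = 0
    ([cauchy_mean]).  The mean over the circle of radius e^s is the integral over
    a vertical segment of a 2 i pi periodic function, obtained by composing with
    the exponential; Goursat's theorem on rectangles ([goursat]) shows that it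
    does not depend on s on either side of the circle through z, continuity
    carries the value across that circle, and the mean tends to 0 as s tends to
    -oo.  Goursat's argument is needed because holomorphy is given as mere
    differentiability. *)

Set Implicit Arguments.
Unset Strict Implicit.
Unset Printing Implicit Defensive.

Import Order.TTheory GRing.Theory Num.Theory.
Import numFieldNormedType.Exports.

Local Open Scope classical_set_scope.
Local Open Scope ring_scope.
Local Open Scope complex_scope.

(** * The modulus as a real number *)

Section Modulus.
Context {R : realType}.
Local Notation C := R[i].
Implicit Types (x y z : C).

Definition cmod z : R := complex.Re `|z|.

Lemma cmodE z : (cmod z)%:C = `|z|. Proof. by []. Qed.

Lemma cmod_le z (M : R) : (`|z| <= M%:C) = (cmod z <= M).
Proof. by rewrite -cmodE lecR. Qed.

Lemma cmod_lt z (M : R) : (`|z| < M%:C) = (cmod z < M).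
Proof. by rewrite -cmodE ltcR. Qed.

Lemma cmod_ge0 z : 0 <= cmod z.
Proof. by rewrite -lecR cmodE normr_ge0. Qed.

Lemma cmodM x y : cmod (x * y) = cmod x * cmod y.
Proof. by apply: complexI; rewrite rmorphM /= !cmodE normrM. Qed.

Lemma cmodX x k : cmod (x ^+ k) = cmod x ^+ k.
Proof. by apply: complexI; rewrite rmorphXn /= !cmodE normrX. Qed.

Lemma cmodD x y : cmod (x + y) <= cmod x + cmod y.
Proof. by rewrite -lecR rmorphD /= !cmodE ler_normD. Qed.

Lemma cmodN x : cmod (- x) = cmod x.
Proof. by rewrite /cmod normrN. Qed.

Lemma cmodC x y : cmod (x - y) = cmod (y - x).
Proof. by rewrite /cmod distrC. Qed.

Lemma cmod0 : cmod 0 = 0.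
Proof. by rewrite /cmod normr0. Qed.

Lemma cmod1 : cmod 1 = 1.
Proof. by rewrite /cmod normr1. Qed.

Lemma cmodV x : cmod x^-1 = (cmod x)^-1.
Proof. by apply: complexI; rewrite fmorphV /= !cmodE normfV. Qed.

Lemma cmod_eq0 z : (cmod z == 0) = (z == 0).
Proof. by rewrite -(inj_eq (@complexI R)) cmodE normr_eq0. Qed.

Lemma cmod_gt0 z : (0 < cmod z) = (z != 0).
Proof. by rewrite lt_neqAle cmod_ge0 andbT eq_sym cmod_eq0. Qed.

Lemma cmod_real (t : R) : cmod t%:C = `|t|.
Proof. by rewrite /cmod normc_def /= expr0n addr0 sqrtr_sqr. Qed.

Lemma cmod_i : cmod 'i%C = 1.
Proof. by rewrite /cmod normc_def /= expr0n expr1n add0r sqrtr1. Qed.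

Lemma cmod_sqr z : cmod z ^+ 2 = complex.Re z ^+ 2 + complex.Im z ^+ 2.
Proof.
by rewrite /cmod normc_def /= sqr_sqrtr // addr_ge0 ?sqr_ge0.
Qed.

Lemma normr_Re_cmod z : `|complex.Re z| <= cmod z.
Proof.
rewrite -(ler_pXn2r (ltn0Sn 1)) ?nnegrE ?cmod_ge0 // cmod_sqr real_normK ?num_real //.
by rewrite lerDl sqr_ge0.
Qed.

Lemma normr_Im_cmod z : `|complex.Im z| <= cmod z.
Proof.
rewrite -(ler_pXn2r (ltn0Sn 1)) ?nnegrE ?cmod_ge0 // cmod_sqr real_normK ?num_real //.
by rewrite lerDr sqr_ge0.
Qed.

Lemma Re_le_cmod z : complex.Re z <= cmod z.
Proof. exact: le_trans (ler_norm _) (normr_Re_cmod z). Qed.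

Lemma cmod_le_ReIm z : cmod z <= `|complex.Re z| + `|complex.Im z|.
Proof.
rewrite {1}[z]complexE; apply: le_trans (cmodD _ _) _.
by rewrite cmodM cmod_i mul1r !cmod_real.
Qed.

Lemma unimodular z : exists2 c, cmod c = 1 & c * z = (cmod z)%:C.
Proof.
have [->|z0] := eqVneq z 0.
  by exists 1; rewrite ?cmod1 // mulr0 cmod0.
exists (`|z| / z).
  by rewrite cmodM cmodV -cmodE cmod_real ger0_norm ?cmod_ge0 // divff ?cmod_eq0.
by rewrite cmodE divfK.
Qed.

Lemma ReD x y : complex.Re (x + y) = complex.Re x + complex.Re y.
Proof. by case: x; case: y. Qed.
Lemma ImD x y : complex.Im (x + y) = complex.Im x + complex.Im y.
Proof. by case: x; case: y. Qed.
Lemma ReN x : complex.Re (- x) = - complex.Re x. Proof. by case: x. Qed.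
Lemma ImN x : complex.Im (- x) = - complex.Im x. Proof. by case: x. Qed.
Lemma ReM x y :
  complex.Re (x * y) = complex.Re x * complex.Re y - complex.Im x * complex.Im y.
Proof. by case: x; case: y. Qed.
Lemma ImM x y :
  complex.Im (x * y) = complex.Re x * complex.Im y + complex.Im x * complex.Re y.
Proof. by case: x; case: y. Qed.

End Modulus.

(** * The Hahn-Banach theorem *)

Section HahnBanach.
Context {R : realType}.
Local Notation C := R[i].

Lemma linear_morph (V W : lmodType C) (f : V -> W) : linear f ->
  [/\ f 0 = 0, forall x y, f (x + y) = f x + f y,
      forall x y, f (x - y) = f x - f y & forall a x, f (a *: x) = a *: f x].
Proof.
move=> lf; have fD x y : f (x + y) = f x + f y.
  by have := lf 1 x y; rewrite !scale1r.
have f0 : f 0 = 0 by apply: (addrI (f 0)); rewrite -fD !addr0.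
have fZ a x : f (a *: x) = a *: f x by have := lf a x 0; rewrite f0 !addr0.
by split=> // x y; rewrite fD -scaleN1r fZ scaleN1r.
Qed.

Definition sublinear (V : lmodType C) (q : V -> R) :=
  (forall x y, q (x + y) <= q x + q y) /\
  (forall (t : R) x, 0 < t -> q (t%:C *: x) = t * q x).

Section Minimal.
Context {V : lmodType C}.
Implicit Types (p q : V -> R) (x y : V).

Lemma sublinear0 q : sublinear q -> q 0 = 0.
Proof.
move=> [_ /(_ 2 0 (ltr0n _ 2))]; rewrite scaler0; lra.
Qed.

Lemma sublinearN q x : sublinear q -> - q (- x) <= q x.
Proof.
move=> sq; have := sq.1 x (- x); rewrite subrr sublinear0 //; lra.
Qed.

(** All the sublinear functionals below are infima of this kind. *)
Lemma inf_sublinear (K : V -> set R) :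
    (forall x, has_inf (K x)) ->
    (forall x y a b, K x a -> K y b -> exists2 c, K (x + y) c & c <= a + b) ->
    (forall t x a, 0 < t -> K x a -> K (t%:C *: x) (t * a)) ->
  sublinear (fun x => inf (K x)).
Proof.
move=> Kinf KD KZ.
have leZ t x : 0 < t -> inf (K (t%:C *: x)) <= t * inf (K x).
  move=> t0; rewrite -ler_pdivrMl //; apply: lb_le_inf; first exact: (Kinf x).1.
  move=> a /(KZ t x a t0) Ka; rewrite ler_pdivrMl //; apply: ge_inf Ka.
  exact: (Kinf _).2.
split=> [x y|t x t0].
  apply/ler_addgt0Pr => e e0.
  have e20 : 0 < e / 2 by rewrite divr_gt0.
  have [a Ka ha] := inf_adherent e20 (Kinf x).
  have [b Kb hb] := inf_adherent e20 (Kinf y).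
  have [c Kc hc] := KD _ _ _ _ Ka Kb.
  have := ge_inf (Kinf (x + y)).2 Kc; lra.
apply/le_anti; rewrite leZ //=.
have ti0 : 0 < t^-1 by rewrite invr_gt0.
have := leZ _ (t%:C *: x) ti0; rewrite scalerA -rmorphM /= mulVf ?gt_eqF //.
by rewrite scale1r ler_pdivlMl.
Qed.

(** Zorn's lemma applies because the infimum of a chain of sublinear functionals
    below p is again sublinear. *)
Lemma minimal_sublinear p : sublinear p -> exists q,
  [/\ sublinear q, forall x, q x <= p x &
      forall q', sublinear q' -> (forall x, q' x <= q x) -> forall x, q x <= q' x].
Proof.
move=> sp.
pose P q := sublinear q /\ forall x, q x <= p x; pose T := {q : V -> R | P q}.
pose ge (s t : T) : bool := `[< forall x, sval t x <= sval s x >].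
have sp' : P p by [].
have [| | |[q [sq qp]] qmin] := @ZL_preorder T (exist P p sp') ge.
- by move=> t; apply/asboolP.
- move=> r s t /asboolP rs /asboolP st; apply/asboolP => x.
  exact: le_trans (st x) (rs x).
- move=> A totA; have [[s0 As0]|A0] := pselect (A !=set0); last first.
    by exists (exist P p sp') => s As; case: A0; exists s.
  pose K x := [set sval s x | s in A].
  have Kinf x : has_inf (K x).
    split; first by exists (sval s0 x), s0.
    (* a sublinear s below p satisfies s x >= - s (- x) >= - p (- x) *)
    exists (- p (- x)) => _ [s As <-]; have [ss sle] := svalP s.
    by have := sublinearN x ss; have := sle (- x); lra.
  have sK : sublinear (fun x => inf (K x)).
    apply: inf_sublinear => // [x y _ _ [s As <-] [t At <-]|t x _ t0 [s As <-]].
      have [/asboolP st|/asboolP ts] := totA s t As At.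
        exists (sval t (x + y)); first by exists t.
        by have := (svalP t).1.1 x y; have := st x; lra.
      exists (sval s (x + y)); first by exists s.
      by have := (svalP s).1.1 x y; have := ts y; lra.
    by exists s; rewrite ?(svalP s).1.2.
  have lbK s : A s -> forall x, inf (K x) <= sval s x.
    by move=> As x; apply: ge_inf (Kinf x).2 _ _; exists s.
  have sK' : P (fun x => inf (K x)).
    by split=> // x; apply: le_trans (lbK _ As0 x) _; exact: (svalP s0).2.
  by exists (exist P _ sK') => s As; apply/asboolP; exact: lbK.
exists q; split=> // q' sq' q'q.
have sq'' : P q'.
  by split=> // x; exact: le_trans (q'q x) (qp x).
by have /asboolP := qmin (exist P q' sq'') (introT (asboolP _) q'q).
Qed.

(** Minimality is used against y |-> inf_{t >= 0} (q (y + t x) - t q x), a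
    sublinear functional below q: the term t = 1 gives
    q y <= q (x + y) - q x, the converse of subadditivity. *)
Lemma minimal_sublinear_additive q : sublinear q ->
    (forall q', sublinear q' -> (forall x, q' x <= q x) ->
      forall x, q x <= q' x) ->
  forall x y, q (x + y) = q x + q y.
Proof.
move=> sq qmin x y; apply/le_anti; rewrite sq.1 /=.
pose K z := [set q (z + t%:C *: x) - t * q x | t in [set t | 0 <= t]].
have q0 := sublinear0 sq.
have qZ t z : 0 <= t -> q (t%:C *: z) = t * q z.
  rewrite le_eqVlt => /predU1P[<-|/sq.2 //].
  by rewrite scale0r q0 mul0r.
have Kinf z : has_inf (K z).
  split; first by exists (q (z + 0%:C *: x) - 0 * q x), 0 => //=.
  exists (- q (- z)) => _ [t /= t0 <-]; have := sq.1 (z + t%:C *: x) (- z).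
  have -> : z + t%:C *: x - z = t%:C *: x by rewrite addrAC subrr add0r.
  by rewrite qZ //; lra.
have sK : sublinear (fun z => inf (K z)).
  apply: inf_sublinear => // [u v _ _ [s /= s0 <-] [t /= t0 <-]|t u _ t0 [s /= s0 <-]].
    exists (q ((u + v) + (s + t)%:C *: x) - (s + t) * q x).
      by exists (s + t) => //=; rewrite addr_ge0.
    rewrite rmorphD /= scalerDl addrACA.
    by have := sq.1 (u + s%:C *: x) (v + t%:C *: x); lra.
  exists (t * s); first by rewrite /= mulr_ge0 // ltW.
  by rewrite rmorphM /= -scalerA -scalerDr sq.2 //; ring.
suff : q y <= q (y + x) - q x by rewrite (addrC y x); lra.
apply: le_trans (qmin _ sK _ y) _ => [z|].
  apply: ge_inf (Kinf z).2 _ _; exists 0 => //=.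
  by rewrite scale0r addr0 mul0r subr0.
apply: ge_inf (Kinf y).2 _ _; exists 1 => //=.
by rewrite scale1r mul1r.
Qed.

End Minimal.

(** The real linear functional below q(v) = inf_w (p (v - T w) + Re phi(w)) is
    the real part of the extension. *)
Lemma hahn_banach (V W : lmodType C) (p : V -> R) (T : W -> V) (phi : W -> C) :
    (forall x y, p (x + y) <= p x + p y) ->
    (forall a x, p (a *: x) = cmod a * p x) ->
    linear T -> linear phi -> (forall w, cmod (phi w) <= p (T w)) ->
  exists mu : V -> C, [/\ linear mu, forall v, cmod (mu v) <= p v &
                          forall w, mu (T w) = phi w].
Proof.
move=> pD pZ lT lphi phip.
have [T0 TD _ TZ] := linear_morph lT; have [f0 fD _ fZ'] := linear_morph lphi.
have fZ a x : phi (a *: x) = a * phi x := fZ' a x.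
have p0 : p 0 = 0 by have := pZ 0 0; rewrite scale0r cmod0 mul0r.
have pN x : p (- x) = p x by rewrite -scaleN1r pZ cmodN cmod1 mul1r.
pose K v := [set p (v - T w) + complex.Re (phi w) | w in setT].
have Kinf v : has_inf (K v).
  split; first by exists (p (v - T 0) + complex.Re (phi 0)), 0.
  exists (- p v) => _ [w _ <-].
  have := phip w; have := normr_Re_cmod (phi w); rewrite ler_norml => /andP[h _].
  by have := pD v (- (v - T w)); rewrite pN opprB addrC subrK; lra.
have sK : sublinear (fun v => inf (K v)).
  apply: inf_sublinear => // [u v _ _ [w _ <-] [w' _ <-]|t v _ t0 [w _ <-]].
    exists (p (u + v - T (w + w')) + complex.Re (phi (w + w'))).
      by exists (w + w').
    by rewrite TD fD ReD opprD addrACA; have := pD (u - T w) (v - T w'); lra.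
  exists (t%:C *: w) => //; rewrite TZ fZ -scalerBr pZ cmod_real gtr0_norm //.
  by rewrite ReM /= mul0r subr0 mulrDr.
have [L [sL Lq Lmin]] := minimal_sublinear sK.
have LD := minimal_sublinear_additive sL Lmin.
have L0 := sublinear0 sL.
have LN x : L (- x) = - L x by apply: (addrI (L x)); rewrite -LD !subrr.
have LZ t x : L (t%:C *: x) = t * L x.
  have [t0|t0|->] := ltrgt0P t; last by rewrite scale0r mul0r.
    exact: sL.2.
  apply: oppr_inj; rewrite -LN -scaleNr -rmorphN /= sL.2 ?oppr_gt0 //.
  by rewrite mulNr.
have Lp v : L v <= p v.
  apply: le_trans (Lq v) _; apply: ge_inf (Kinf v).2 _ _; exists 0 => //.
  by rewrite T0 f0 subr0 addr0.
have LTle w : L (T w) <= complex.Re (phi w).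
  apply: le_trans (Lq _) _; apply: ge_inf (Kinf _).2 _ _; exists w => //.
  by rewrite subrr p0 add0r.
have LT w : L (T w) = complex.Re (phi w).
  apply/le_anti; rewrite LTle /=; have := LTle (- w).
  by rewrite -scaleN1r TZ fZ scaleN1r mulN1r LN ReN lerN2.
pose mu v : C := L v +i* (- L ('i%C *: v)).
have muE v : mu v = L v +i* (- L ('i%C *: v)) by [].
have muD x y : mu (x + y) = mu x + mu y.
  by rewrite !muE scalerDr !LD opprD.
have muZ a x : mu (a *: x) = a * mu x.
  rewrite [in LHS](complexE a) scalerDl muD.
  have mut t y : mu (t%:C *: y) = t%:C * mu y.
    by rewrite !muE scalerA [_ * t%:C]mulrC -scalerA !LZ; simpc.
  have mui y : mu ('i%C *: y) = 'i%C * mu y.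
    rewrite !muE scalerA -expr2 sqr_i scaleN1r LN opprK.
    by simpc.
  by rewrite -scalerA mui !mut mulrA -mulrDl -complexE.
exists mu; split=> [a x y|v|w].
- by rewrite muD muZ.
- have [c c1 cmu] := unimodular (mu v).
  have -> : cmod (mu v) = L (c *: v).
    by have := congr1 (@complex.Re R) cmu; rewrite -muZ.
  by apply: le_trans (Lp _) _; rewrite pZ c1 mul1r.
- rewrite muE LT -TZ LT fZ ReM /= mul0r mul1r sub0r opprK.
  by case: (phi w).
Qed.

End HahnBanach.

(** * Functionals annihilating an M-ideal *)

Section MIdealModule.
Context {R : realType} {X : normedModType R[i]}.
Local Notation C := R[i].
Implicit Types (J : set X) (phi psi : dual X).

Definition rnorm {Y : normedModType C} (x : Y) : R := complex.Re `|x|.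

Lemma rnormE {Y : normedModType C} (x : Y) : (rnorm x)%:C = `|x|.
Proof.
have := normr_ge0 x.
by rewrite /rnorm; case: `|x| => a b; rewrite lecE /= => /andP[/eqP ->].
Qed.

Lemma rnorm_ge0 {Y : normedModType C} (x : Y) : 0 <= rnorm x.
Proof. by rewrite -lecR rnormE normr_ge0. Qed.

Lemma rnormD {Y : normedModType C} (x y : Y) : rnorm (x + y) <= rnorm x + rnorm y.
Proof. by rewrite -lecR rmorphD /= !rnormE ler_normD. Qed.

Lemma rnormZ {Y : normedModType C} a (x : Y) : rnorm (a *: x) = cmod a * rnorm x.
Proof. by apply: complexI; rewrite rmorphM /= !rnormE cmodE normrZ. Qed.

Lemma rnorm_eq0 {Y : normedModType C} (x : Y) : (rnorm x == 0) = (x == 0).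
Proof. by rewrite -(inj_eq (@complexI R)) rnormE normr_eq0. Qed.

Lemma dual_le phi x : cmod (phi x) <= rnorm phi * rnorm x.
Proof.
have [->|x0] := eqVneq x 0; first by rewrite linear0 cmod0 mulr_ge0 ?rnorm_ge0.
have rx : 0 < rnorm x by rewrite lt_neqAle rnorm_ge0 andbT eq_sym rnorm_eq0.
have : `|(rnorm x)^-1%:C *: x| <= 1.
  rewrite -rnormE -[1]/(1%:C) lecR rnormZ cmod_real ger0_norm ?invr_ge0 ?rnorm_ge0 //.
  by rewrite mulVf // gt_eqF.
move=> /(sup_norm_ub (dual_bounded phi)); rewrite -cmodE lecR linearZ cmodM.
rewrite cmod_real ger0_norm ?invr_ge0 ?rnorm_ge0 // mulrC ler_pdivrMr //.
Qed.

Lemma dual_norm_le phi (M : R) :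
  (forall x, rnorm x <= 1 -> cmod (phi x) <= M) -> rnorm phi <= M.
Proof.
move=> phiM; apply: (@sup_norm_le R X) => [|x]; first exact: unit_ball_neq0.
by rewrite /= -rnormE -[1]/(1%:C) lecR cmod_le; exact: phiM.
Qed.

Lemma bounded_linear_dual (f : X -> C) (M : R) :
  linear f -> (forall x, cmod (f x) <= M * rnorm x) -> f \in dual_pred.
Proof.
move=> lf fM; apply/asboolP; split=> //.
pose f' : {linear X -> C} := HB.pack f (GRing.isLinear.Build C X C *:%R f lf).
have /bounded_linear_continuous : bounded_near f' (nbhs 0).
  apply/linear_boundedP; exists M%:C; split=> [|r /ltW Mr x].
    by rewrite realE !lecE /= !eqxx /= le_total.
  apply: (@le_trans _ _ (M%:C * `|x|)); last by rewrite ler_wpM2r.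
  by rewrite -cmodE -rnormE -rmorphM lecR.
by [].
Qed.

(** The projections of psi and phi - psi already exhaust the norm of phi, which
    leaves nothing for their components in the kernel of the L-projection. *)
Lemma M_ideal_summand J phi psi : M_ideal J -> annihilator J phi ->
  rnorm psi + rnorm (phi - psi) <= rnorm phi -> annihilator J psi.
Proof.
move=> [_ [P [_ PP ranP PL]]]; rewrite -ranP => -[eta _ etaE] le.
have Pphi : P phi = phi by rewrite -etaE PP.
have L chi : rnorm (P chi) + rnorm (chi - P chi) = rnorm chi.
  by apply: complexI; rewrite rmorphD /= !rnormE PL.
have psi0 : rnorm (psi - P psi) = 0.
  have := L psi; have := L (phi - psi); have := rnormD (P psi) (P (phi - psi)).
  rewrite -linearD /= addrC subrK Pphi.
  have := rnorm_ge0 (psi - P psi); have := rnorm_ge0 (phi - psi - P (phi - psi)).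
  lra.
by exists psi => //; apply/esym/eqP; rewrite -subr_eq0 -rnorm_eq0 psi0.
Qed.

(** U plays the role of multiplication by a function with values in [0, 1]: the
    last hypothesis makes the two pieces mu U and mu (1 - U) of a norm-preserving
    extension mu of phi restrict to functionals whose norms add up to at most that
    of phi, so that [M_ideal_summand] applies. *)
Lemma M_ideal_extension J phi (V : lmodType C) (p : V -> R) (iota : X -> V)
    (mu : V -> C) (U : V -> V) :
    M_ideal J -> annihilator J phi ->
    linear iota -> linear mu -> linear U ->
    (forall x, p (iota x) <= rnorm x) ->
    (forall v, cmod (mu v) <= rnorm phi * p v) ->
    (forall x, mu (iota x) = phi x) ->
    (forall v w, p v <= 1 -> p w <= 1 -> p (U v + (w - U w)) <= 1) ->
  forall x, J x -> mu (U (iota x)) = 0.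
Proof.
move=> hJ Jphi liota lmu lU piota pmu muphi pU.
have [i0 _ _ iZ] := linear_morph liota; have [U0 _ _ UZ] := linear_morph lU.
have [m0 mD mB mZ'] := linear_morph lmu.
have mZ a x : mu (a *: x) = a * mu x := mZ' a x.
have pi1 x : rnorm x <= 1 -> p (iota x) <= 1 by exact: le_trans.
have r0 : rnorm (0 : X) = 0 by rewrite /rnorm normr0.
(* rotating x and y makes both values nonnegative, hence a single value of mu *)
have split x y : rnorm x <= 1 -> rnorm y <= 1 ->
    cmod (mu (U (iota x))) + cmod (mu (iota y - U (iota y))) <= rnorm phi.
  move=> x1 y1; have [c c1 cE] := unimodular (mu (U (iota x))).
  have [d d1 dE] := unimodular (mu (iota y - U (iota y))).
  have cx1 : rnorm (c *: x) <= 1 by rewrite rnormZ c1 mul1r.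
  have dy1 : rnorm (d *: y) <= 1 by rewrite rnormZ d1 mul1r.
  have := pU _ _ (pi1 _ cx1) (pi1 _ dy1).
  move=> /(ler_wpM2l (rnorm_ge0 phi)); rewrite mulr1; apply: le_trans.
  apply: le_trans _ (pmu _); apply: le_trans _ (Re_le_cmod _).
  by rewrite !iZ !UZ -scalerBr [mu (c *: _ + _)]mD !mZ cE dE.
have psiP : (mu \o U \o iota) \in dual_pred.
  apply: (@bounded_linear_dual _ (rnorm phi)) => [a x y /=|x /=].
    by rewrite liota lU lmu.
  have [->|x0] := eqVneq x 0.
    by rewrite i0 U0 m0 cmod0 mulr_ge0 ?rnorm_ge0.
  have rx : 0 < rnorm x by rewrite lt_neqAle rnorm_ge0 andbT eq_sym rnorm_eq0.
  have r1 : rnorm ((rnorm x)^-1%:C *: x) <= 1.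
    rewrite rnormZ cmod_real ger0_norm ?invr_ge0 ?rnorm_ge0 //.
    by rewrite mulVf // gt_eqF.
  have := split _ 0 r1; rewrite r0 => /(_ ler01).
  rewrite i0 U0 subr0 m0 cmod0 addr0.
  rewrite iZ UZ mZ cmodM cmod_real ger0_norm ?invr_ge0 ?rnorm_ge0 //.
  by rewrite mulrC ler_pdivrMr.
pose psi := MkDual psiP.
have := M_ideal_summand (psi := psi) hJ Jphi; apply.
rewrite -lerBrDr; apply: dual_norm_le => x x1.
rewrite lerBrDr addrC -lerBrDr; apply: dual_norm_le => y y1.
have -> : (phi - psi) y = mu (iota y - U (iota y)) by rewrite mB muphi.
by rewrite lerBrDr addrC; exact: split.
Qed.

(** The functional d c on the line spanned by a point at distance d from J is
    dominated by the distance to J. *)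
Lemma annihilator_separates J g : closed_subspace J -> ~ J g ->
  exists2 phi : dual X, annihilator J phi & phi g <> 0.
Proof.
move=> [cJ J0 lJ] Jg.
have JD x y : J x -> J y -> J (x + y).
  by move=> Jx Jy; have := lJ 1 x y Jx Jy; rewrite scale1r.
have JZ a x : J x -> J (a *: x).
  by move=> Jx; have := lJ a x 0 Jx J0; rewrite addr0.
pose K x := [set rnorm (x - y) | y in J].
have Kinf x : has_inf (K x).
  by split; [exists (rnorm (x - 0)), 0|exists 0 => _ [y _ <-]; exact: rnorm_ge0].
pose p x := inf (K x).
have sp : sublinear p.
  apply: inf_sublinear => // [x y _ _ [a Ja <-] [b Jb <-]|t x _ t0 [a Ja <-]].
    exists (rnorm (x + y - (a + b))); first by exists (a + b) => //; exact: JD.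
    by rewrite opprD addrACA; exact: rnormD.
  exists (t%:C *: a); first exact: JZ.
  by rewrite -scalerBr rnormZ cmod_real gtr0_norm.
have p0 x : 0 <= p x.
  apply: lb_le_inf; first exact: (Kinf x).1.
  by move=> _ [y _ <-]; exact: rnorm_ge0.
have ple x y : J y -> p x <= rnorm (x - y).
  by move=> Jy; apply: ge_inf (Kinf x).2 _ _; exists y.
have pJ x : J x -> p x = 0.
  move=> Jx; apply/le_anti; rewrite p0 andbT.
  by have := ple x x Jx; rewrite subrr /rnorm normr0.
have pZle a x : p (a *: x) <= cmod a * p x.
  have [->|a0] := eqVneq a 0; first by rewrite scale0r cmod0 mul0r pJ.
  rewrite -ler_pdivrMl ?cmod_gt0 //; apply: lb_le_inf; first exact: (Kinf x).1.
  move=> _ [y Jy <-]; rewrite ler_pdivrMl ?cmod_gt0 // -rnormZ scalerBr.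
  exact/ple/JZ.
have pZ a x : p (a *: x) = cmod a * p x.
  apply/le_anti; rewrite pZle /=.
  have [->|a0] := eqVneq a 0; first by rewrite cmod0 mul0r p0.
  have := pZle a^-1 (a *: x); rewrite scalerA mulVf // scale1r cmodV.
  by rewrite mulrC ler_pdivlMr ?cmod_gt0 // mulrC.
have pg : p g != 0.
  apply/eqP => pg0; apply: Jg; rewrite (closure_id J).1 // => B.
  move=> /nbhs_normP[[e ei] /=]; rewrite ltcE /= => /andP[/eqP -> e0] sB.
  have [_ [y Jy <-]] := inf_adherent e0 (Kinf g).
  rewrite -/(p g) pg0 add0r => ge.
  by exists y; split=> //; apply: sB; rewrite /= -rnormE ltcR.
have [||a|mu [lmu pmu muT]] :=
  @hahn_banach R X C p (fun c => c *: g) (fun c => c * (p g)%:C) sp.1 pZ.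
- by move=> a x y; rewrite scalerDl -scalerA.
- by move=> a x y; rewrite mulrDl; congr (_ + _); exact: esym (mulrA _ _ _).
- by rewrite cmodM cmod_real ger0_norm // pZ.
have muP : mu \in dual_pred.
  apply: (@bounded_linear_dual _ 1) => // x; rewrite mul1r.
  by apply: le_trans (pmu x) _; rewrite -[leRHS]/(rnorm x) -[in leRHS](subr0 x) ple.
exists (MkDual muP) => [x Jx /=|/=].
  by apply/eqP; rewrite -cmod_eq0; apply/eqP/le_anti; rewrite cmod_ge0 andbT -(pJ x Jx).
have := muT 1; rewrite scale1r mul1r => -> /complexI; exact/eqP.
Qed.

End MIdealModule.

(** * Cancellation of functions bounded below on a norming set *)

Section BoundedFunctions.
Context {R : realType} {T : Type} (A : set T).
Local Notation C := R[i].

Definition bounded_pred : {pred T -> C} := fun f =>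
  `[< [bounded f x | x in A] >].

Lemma bounded_submod_closed : submod_closed bounded_pred.
Proof.
split; first exact/asboolP/(bounded_on_cst A 0).
move=> a f g /asboolP bf /asboolP bg; apply/asboolP.
by apply: bounded_onD => //; exact: bounded_onZ.
Qed.

HB.instance Definition _ := GRing.isSubmodClosed.Build C (T -> C)
  bounded_pred bounded_submod_closed.

End BoundedFunctions.

Record bfun (R : realType) (T : Type) (A : set T) := MkBfun {
  bfun_val :> T -> R[i];
  bfun_valP : bfun_val \in bounded_pred A }.

HB.instance Definition _ R T A := [isSub for @bfun_val R T A].
HB.instance Definition _ R T A := [Choice of @bfun R T A by <:].
HB.instance Definition _ R T A := [SubChoice_isSubLmodule of @bfun R T A by <:].

Section BoundedFunctionTheory.
Context {R : realType} {T : Type} {A : set T}.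
Local Notation C := R[i].
Local Notation B := (bfun R A).

Lemma bfun_bounded (v : B) : [bounded v x | x in A].
Proof. by have /asboolP := bfun_valP v. Qed.

Lemma sup_norm_cmod_le (v : T -> C) (M : R) : A !=set0 ->
  (forall x, A x -> cmod (v x) <= M) -> sup_norm A v <= M.
Proof. by move=> A0 h; apply: sup_norm_le => // x /h; rewrite cmod_le. Qed.

Lemma cmod_le_sup_norm (v : B) x : A x -> cmod (v x) <= sup_norm A v.
Proof. by move=> Ax; rewrite -cmod_le; exact: sup_norm_ub (bfun_bounded v) Ax. Qed.

Lemma bfun_mul_subproof (u v : B) : (u : T -> C) * v \in bounded_pred A.
Proof. by apply/asboolP/bounded_onM; exact: bfun_bounded. Qed.

Definition bfun_mul (u v : B) : B := MkBfun (bfun_mul_subproof u v).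

Lemma bfun_mul_linear u : linear (bfun_mul u).
Proof.
move=> a v w; apply/val_inj/funext => x /=.
by rewrite -[LHS]/(u x * (a * v x + w x)) mulrDr mulrCA.
Qed.

Lemma bfun_real_subproof (u : T -> R) (K : R) :
  (forall x, A x -> `|u x| <= K) -> (fun x => (u x)%:C) \in bounded_pred A.
Proof.
move=> uK; apply/asboolP/bounded_onP; exists K => x /uK.
by rewrite cmod_le cmod_real.
Qed.

End BoundedFunctionTheory.

Section Division.
Context {R : realType} {n : nat}.
Local Notation C := R[i].
Local Notation H := (Hinf R n).

(** Restricted to a norming set on which f is bounded away from 0, the algebra
    sits isometrically in an algebra of bounded functions containing 1/f; a
    norm-preserving extension mu of an annihilating functional then satisfies
    phi g = mu (1/f * (f g)) = 0. *)
Lemma M_ideal_cancel (J : set H) (f g : H) (A : set 'rV[C]_n) (delta : R) :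
    M_ideal J -> A !=set0 -> A `<=` polydisc -> 0 < delta ->
    (forall z, A z -> delta <= cmod (f z)) ->
    (forall (h : H) M, (forall z, A z -> cmod (h z) <= M) ->
      forall z, polydisc z -> cmod (h z) <= M) ->
  J (f * g) -> J g.
Proof.
move=> hJ A0 AD d0 fd norming Jfg; apply: contrapT => Jg.
have [phi Jphi] := annihilator_separates hJ.1 Jg; apply.
have iP (h : H) : (h : 'rV[C]_n -> C) \in bounded_pred A.
  apply/asboolP/bounded_onP; exists (sup_norm polydisc h) => x /AD.
  exact: sup_norm_ub (Hinf_bounded h).
pose iota h : bfun R A := MkBfun (iP h).
have liota : linear iota by move=> a x y; apply/val_inj.
pose p (v : bfun R A) := rnorm phi * sup_norm A v.
have [||h|mu [lmu mup muE]] :=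
    @hahn_banach R (bfun R A) H p iota phi _ _ liota (dual_linear phi).
- move=> x y; rewrite /p -mulrDr ler_wpM2l ?rnorm_ge0 //.
  by apply: sup_normD => //; exact: bfun_bounded.
- move=> a x; rewrite /p mulrCA; congr (_ * _); apply: complexI.
  by rewrite rmorphM /= cmodE -sup_normZ //; exact: bfun_bounded.
- apply: le_trans (dual_le _ _) _; rewrite ler_wpM2l ?rnorm_ge0 //.
  apply: sup_norm_cmod_le polydisc_neq0 _ => z zD.
  by apply: norming zD => {}z Az; exact: cmod_le_sup_norm (iota h) _ Az.
have piota h : sup_norm A (iota h) <= rnorm h.
  apply: sup_norm_cmod_le => // z /AD zD; rewrite -cmod_le.
  exact: sup_norm_ub (Hinf_bounded h) zD.
have [_ muD muB muZ'] := linear_morph lmu.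
have muZ a x : mu (a *: x) = a * mu x := muZ' a x.
have mu_ext (v w : bfun R A) : (forall z, A z -> v z = w z) -> mu v = mu w.
  move=> vw; apply/eqP; rewrite -subr_eq0 -muB -cmod_eq0; apply/eqP/le_anti.
  rewrite cmod_ge0 andbT; apply: le_trans (mup _) _.
  rewrite mulr_ge0_le0 ?rnorm_ge0 //.
  by apply: sup_norm_cmod_le => // z /vw e; rewrite /= !fctE e subrr cmod0.
have real01 (u : 'rV[C]_n -> R) (uA : (fun x => (u x)%:C) \in bounded_pred A) :
    (forall z, A z -> 0 <= u z <= 1) ->
    forall x, J x -> mu (bfun_mul (MkBfun uA) (iota x)) = 0.
  move=> u01; apply: (M_ideal_extension (p := fun v : bfun R A => sup_norm A v)) => //.
  + exact: Jphi.
  + exact: bfun_mul_linear.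
  + exact: mup.
  + move=> v w v1 w1; apply: sup_norm_cmod_le => // z Az.
    rewrite -[X in cmod X]/((u z)%:C * v z + (w z - (u z)%:C * w z)).
    have -> : (u z)%:C * v z + (w z - (u z)%:C * w z) =
      (u z)%:C * v z + (1 - u z)%:C * w z by rewrite rmorphB /= mulrBl mul1r.
    have /andP[u0 u1] := u01 z Az; apply: le_trans (cmodD _ _) _.
    rewrite !cmodM !cmod_real (ger0_norm u0) ger0_norm ?subr_ge0 //.
    have := le_trans (cmod_le_sup_norm v Az) v1.
    have := le_trans (cmod_le_sup_norm w Az) w1.
    by have := cmod_ge0 (v z); have := cmod_ge0 (w z); nra.
pose K := delta^-1; have K0 : 0 < K by rewrite invr_gt0.
pose w z := (f z)^-1.
have wK z : A z -> cmod (w z) <= K.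
  move=> /fd fz; rewrite cmodV lef_pV2 // posrE //.
  exact: lt_le_trans fz.
(* on A, 1/f = 2K u1 + 2K i u2 - (K + i K) with u1 and u2 between 0 and 1 *)
pose u1 z := (K^-1 * complex.Re (w z) + 1) / 2.
pose u2 z := (K^-1 * complex.Im (w z) + 1) / 2.
have ball01 (t : R) : `|t| <= K -> 0 <= (K^-1 * t + 1) / 2 <= 1.
  rewrite ler_norml => /andP[h1 h2].
  have h3 : -1 <= K^-1 * t by rewrite mulrC ler_pdivlMr // mulN1r.
  have h4 : K^-1 * t <= 1 by rewrite mulrC ler_pdivrMr // mul1r.
  by apply/andP; split; lra.
have u101 z : A z -> 0 <= u1 z <= 1.
  by move=> /wK wz; apply: ball01; exact: le_trans (normr_Re_cmod _) wz.
have u201 z : A z -> 0 <= u2 z <= 1.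
  by move=> /wK wz; apply: ball01; exact: le_trans (normr_Im_cmod _) wz.
have bd (u : 'rV[C]_n -> R) : (forall z, A z -> 0 <= u z <= 1) ->
    (fun x => (u x)%:C) \in bounded_pred A.
  move=> u01; apply: (@bfun_real_subproof _ _ _ _ 1) => z /u01 /andP[? ?].
  by rewrite ger0_norm.
have e1 := real01 _ (bd _ u101) u101 _ Jfg.
have e2 := real01 _ (bd _ u201) u201 _ Jfg.
rewrite -muE.
rewrite (mu_ext _ ((2 * K)%:C *: bfun_mul (MkBfun (bd _ u101)) (iota (f * g)) +
  ('i%C * (2 * K)%:C) *: bfun_mul (MkBfun (bd _ u201)) (iota (f * g)) -
  (K%:C + 'i%C * K%:C) *: iota (f * g))) => [|z Az]; last first.
  rewrite -[RHS]/((2 * K)%:C * ((u1 z)%:C * (f z * g z)) +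
    ('i%C * (2 * K)%:C) * ((u2 z)%:C * (f z * g z)) -
    (K%:C + 'i%C * K%:C) * (f z * g z)).
  have fz0 : f z != 0.
    by rewrite -cmod_gt0; exact: lt_le_trans d0 (fd z Az).
  have eR : (2 * K)%:C * (u1 z)%:C = (complex.Re (w z))%:C + K%:C.
    by rewrite -rmorphM -rmorphD /u1; congr _%:C; field; exact/lt0r_neq0.
  have eI : (2 * K)%:C * (u2 z)%:C = (complex.Im (w z))%:C + K%:C.
    by rewrite -rmorphM -rmorphD /u2; congr _%:C; field; exact/lt0r_neq0.
  rewrite !mulrA eR -['i%C * _ * _]mulrA eI.
  transitivity (w z * (f z * g z)); first by rewrite mulKf.
  by rewrite {1}(complexE (w z)); ring.
by rewrite muB muD !muZ e1 e2 muE (Jphi _ Jfg) !mulr0 addr0 subr0.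
Qed.

End Division.

(** * Continuity and differentiability in one complex variable *)

Section ComplexLimits.
Context {R : realType}.
Local Notation C := R[i].

Lemma cvg_cmodP {T : Type} {F : set_system T} {FF : Filter F} (f : T -> C) (l : C) :
  f @ F --> l <-> forall e : R, 0 < e -> \forall t \near F, cmod (f t - l) < e.
Proof.
split=> [/cvgrPdistC_lt h e e0|h].
  have /h : 0 < e%:C by rewrite ltcR.
  by apply: filterS => t; rewrite cmod_lt.
apply/cvgrPdistC_lt => e e0.
have eE : e = (complex.Re e)%:C.
  by move: e0; rewrite ltcE /= => /andP[/eqP]; case: (e) => a b /= ->.
have : 0 < complex.Re e by rewrite -ltcR -eE.
by move=> /h; apply: filterS => t; rewrite eE cmod_lt.
Qed.

Lemma near_cmodP (x : C) (P : C -> Prop) : (\forall y \near x, P y) <->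
  exists2 d : R, 0 < d & forall y, cmod (y - x) < d -> P y.
Proof.
split=> [/nbhs_normP[[e ei] /=]|[d d0 dP]].
  rewrite ltcE /= => /andP[/eqP -> e0] sP; exists e => // y yx.
  by apply: sP; rewrite /= distrC -cmodE ltcR.
apply/nbhs_normP; exists d%:C; first by rewrite /= ltcR.
by move=> y /=; rewrite distrC -cmodE ltcR; exact: dP.
Qed.

Lemma near_dnbhs_cmodP (x : C) (P : C -> Prop) : (\forall y \near x^', P y) <->
  exists2 d : R, 0 < d & forall y, cmod (y - x) < d -> y != x -> P y.
Proof. rewrite /dnbhs near_withinE; exact: near_cmodP. Qed.

Lemma cvg_Re {T : Type} {F : set_system T} {FF : Filter F} (f : T -> C) (l : C) :
  f @ F --> l -> (complex.Re (f t) : R) @[t --> F] --> (complex.Re l : R).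
Proof.
move=> /cvg_cmodP h; apply/cvgrPdistC_lt => e /h; apply: filterS => t.
by apply: le_lt_trans; rewrite -ReN -ReD normr_Re_cmod.
Qed.

Lemma cvg_Im {T : Type} {F : set_system T} {FF : Filter F} (f : T -> C) (l : C) :
  f @ F --> l -> (complex.Im (f t) : R) @[t --> F] --> (complex.Im l : R).
Proof.
move=> /cvg_cmodP h; apply/cvgrPdistC_lt => e /h; apply: filterS => t.
by apply: le_lt_trans; rewrite -ImN -ImD normr_Im_cmod.
Qed.

Lemma cvg_complex {T : Type} {F : set_system T} {FF : Filter F} (f g : T -> R)
    (a b : R) :
  f @ F --> a -> g @ F --> b -> (f t +i* g t : C) @[t --> F] --> (a +i* b : C).
Proof.
move=> /cvgrPdistC_lt hf /cvgrPdistC_lt hg; apply/cvg_cmodP => e e0.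
have e20 : 0 < e / 2 by rewrite divr_gt0.
near=> t; apply: le_lt_trans (cmod_le_ReIm _) _ => /=.
have : `|f t - a| < e / 2 by near: t; exact: hf.
have : `|g t - b| < e / 2 by near: t; exact: hg.
by lra.
Unshelve. all: by end_near. Qed.

Lemma cvg_cmod {T : Type} {F : set_system T} {FF : Filter F} (f : T -> C) (l : C) :
  f @ F --> l -> (cmod (f t) : R) @[t --> F] --> (cmod l : R).
Proof.
move=> /cvg_cmodP h; apply/cvgrPdistC_lt => e /h; apply: filterS => t.
apply: le_lt_trans; rewrite ler_norml lerBrDr addrC lerBlDr.
have := cmodD (f t - l) l; have := cmodD (l - f t) (f t).
by rewrite !subrK (cmodC l) => h1 h2; apply/andP; split; lra.
Qed.

End ComplexLimits.

Section ComplexDifferentiability.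
Context {R : realType}.
Local Notation C := R[i].
Implicit Types (f g q : C -> C) (x y z : C).

Definition ccont f x := forall e : R, 0 < e ->
  exists2 d : R, 0 < d & forall y, cmod (y - x) < d -> cmod (f y - f x) < e.

Lemma ccontP f x : ccont f x <-> f y @[y --> x] --> f x.
Proof.
have P := @cvg_cmodP R C (nbhs x) (nbhs_filter x) f (f x).
by split=> [h|/P.1 h e /h/near_cmodP //]; apply: P.2 => e /h/near_cmodP.
Qed.

Lemma ccont_cst a x : ccont (fun=> a) x.
Proof. by move=> e e0; exists 1 => // y _; rewrite subrr cmod0. Qed.

Lemma ccont_id x : ccont (fun y => y) x.
Proof. by move=> e e0; exists e. Qed.

Lemma ccontD f g x : ccont f x -> ccont g x -> ccont (fun y => f y + g y) x.
Proof.
move=> /ccontP cf /ccontP cg; apply/ccontP.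
exact: (@cvgD C C _ (nbhs x) (nbhs_filter x) f g _ _ cf cg).
Qed.

Lemma ccontB f g x : ccont f x -> ccont g x -> ccont (fun y => f y - g y) x.
Proof.
move=> /ccontP cf /ccontP cg; apply/ccontP.
exact: (@cvgB C C _ (nbhs x) (nbhs_filter x) f g _ _ cf cg).
Qed.

Lemma ccontM f g x : ccont f x -> ccont g x -> ccont (fun y => f y * g y) x.
Proof.
move=> /ccontP cf /ccontP cg; apply/ccontP.
exact: (@cvgM C _ (nbhs x) (nbhs_filter x) f g _ _ cf cg).
Qed.

Lemma ccontV f x : f x != 0 -> ccont f x -> ccont (fun y => (f y)^-1) x.
Proof.
move=> f0 /ccontP cf; apply/ccontP.
exact: (@cvgV C _ (nbhs x) (nbhs_filter x) f _ f0 cf).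
Qed.

Lemma ccont_comp f g x : ccont f x -> ccont g (f x) -> ccont (fun y => g (f y)) x.
Proof.
move=> cf cg e /cg[d /cf[d' d'0 hf] hg]; exists d' => // y /hf; exact: hg.
Qed.

Lemma ccont_near f g x (d : R) : 0 < d ->
  (forall y, cmod (y - x) < d -> f y = g y) -> ccont f x -> ccont g x.
Proof.
move=> d0 fg cf e /cf[d' d'0 h].
have fgx : f x = g x by apply: fg; rewrite subrr cmod0.
exists (Num.min d d') => [|y]; first by rewrite lt_min d0.
by rewrite lt_min => /andP[yd yd']; rewrite -fgx -(fg _ yd); exact: h.
Qed.

(** Caratheodory's form of differentiability: the difference quotient, which
    the Cauchy kernel needs anyway, is part of the data. *)
Definition cdiff f x := exists2 q, ccont q x &
  forall y, f y = f x + q y * (y - x).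

Lemma cdiff_continuous f x : cdiff f x -> ccont f x.
Proof.
move=> [q cq fE].
have -> : f = fun y => f x + q y * (y - x) by apply/funext => y; exact: fE.
apply: ccontD; first exact: ccont_cst.
by apply: ccontM => //; apply: ccontB; [exact: ccont_id|exact: ccont_cst].
Qed.

Lemma cdiff_quotient f q x (d : R) : 0 < d -> ccont q x ->
  (forall y, cmod (y - x) < d -> y != x -> f y = f x + q y * (y - x)) ->
  cdiff f x.
Proof.
move=> d0 cq fE.
exists (fun y => if y == x then q x else (f y - f x) / (y - x)); last first.
  move=> y; have [->|yx] := eqVneq y x; first by rewrite subrr mulr0 addr0.
  by rewrite divfK ?subr_eq0 // addrC subrK.
apply: (ccont_near d0 _ cq) => y yd; case: ifP => [/eqP -> //|/negbT yx].
by rewrite (fE y yd yx) addrC addKr mulfK // subr_eq0.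
Qed.

Lemma cdiff_near f g x (d : R) : 0 < d ->
  (forall y, cmod (y - x) < d -> f y = g y) -> cdiff f x -> cdiff g x.
Proof.
move=> d0 fg [q cq fE]; apply: (cdiff_quotient d0 cq) => y yd _.
by rewrite -fg // fE fg // subrr cmod0.
Qed.

Lemma derivable_cdiff f x : derivable f x 1 -> cdiff f x.
Proof.
rewrite /derivable => /cvg_ex[l fl].
exists (fun y => if y == x then l else (f y - f x) / (y - x)); last first.
  move=> y; have [->|yx] := eqVneq y x; first by rewrite subrr mulr0 addr0.
  by rewrite divfK ?subr_eq0 // addrC subrK.
move=> e e0.
move/(@cvg_cmodP _ _ (0^')) : fl => /(_ e e0)/near_dnbhs_cmodP[d d0 hd].
exists d => // y yd; rewrite eqxx; case: ifPn => [_|yx].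
  by rewrite subrr cmod0.
have := hd (y - x); rewrite subr0 subr_eq0 => /(_ yd yx).
have -> : (y - x) *: 1 = y - x := mulr1 (y - x).
by rewrite /= subrK => h; rewrite mulrC; exact: h.
Qed.

Lemma cdiff_comp f g x : cdiff f x -> cdiff g (f x) ->
  cdiff (fun y => g (f y)) x.
Proof.
move=> df; have cf := cdiff_continuous df; case: df => q cq fE [r cr gE].
exists (fun y => r (f y) * q y); first by apply: ccontM => //; exact: ccont_comp cf cr.
move=> y /=; rewrite gE -mulrA; congr (_ + _ * _).
by rewrite {1}fE addrC addKr.
Qed.

Lemma cdiffM f g x : cdiff f x -> cdiff g x -> cdiff (fun y => f y * g y) x.
Proof.
move=> [q cq fE] dg; have cg := cdiff_continuous dg; case: dg => r cr gE.
exists (fun y => q y * g y + f x * r y).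
  by apply: ccontD; apply: ccontM => //; exact: ccont_cst.
by move=> y; rewrite [f y]fE [g y]gE; ring.
Qed.

Lemma cdiff_id x : cdiff (fun y => y) x.
Proof.
by exists (fun=> 1) => [|y]; [exact: ccont_cst|rewrite mul1r addrC subrK].
Qed.

Lemma cdiff_cst a x : cdiff (fun=> a) x.
Proof.
by exists (fun=> 0) => [|y]; [exact: ccont_cst|rewrite mul0r addr0].
Qed.

(** If r is the difference quotient of f at w, then that of q at w is
    (r y - q w) / (y - z), which is continuous at w since w is not z. *)
Lemma cdiff_difference_quotient f q z w : w != z -> cdiff f w ->
  (forall y, f y = f z + q y * (y - z)) -> cdiff q w.
Proof.
move=> wz [r cr fE] qE.
have wz0 : w - z != 0 by rewrite subr_eq0.
have d0 : 0 < cmod (w - z) by rewrite cmod_gt0.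
apply: (@cdiff_quotient _ (fun y => (r y - q w) / (y - z)) _ _ d0).
  apply: ccontM; first by apply: ccontB => //; exact: ccont_cst.
  by apply: ccontV => //; apply: ccontB; [exact: ccont_id|exact: ccont_cst].
move=> y yd yw.
have yz : y - z != 0.
  by rewrite subr_eq0; apply: contraTneq yd => ->; rewrite cmodC ltxx.
have qE' u : u - z != 0 -> q u = (f u - f z) / (u - z).
  by move=> uz; rewrite [f u]qE addrC addKr mulfK.
by rewrite (qE' y) // (qE' w) // [f y]fE; field; rewrite wz0 yz.
Qed.

End ComplexDifferentiability.

(** * The complex exponential *)

Section ComplexExponential.
Context {R : realType}.
Local Notation C := R[i].
Implicit Types (w z : C).

Definition eit (t : R) : C := cos t +i* sin t.

Definition cexp w : C := (expR (complex.Re w))%:C * eit (complex.Im w).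

Lemma cmod_eit t : cmod (eit t) = 1.
Proof.
apply/eqP; rewrite -(@eqrXn2 _ 2) ?cmod_ge0 // expr1n cmod_sqr /=.
by rewrite cos2Dsin2.
Qed.

Lemma cmod_cexp w : cmod (cexp w) = expR (complex.Re w).
Proof. by rewrite cmodM cmod_eit mulr1 cmod_real ger0_norm ?expR_ge0. Qed.

Lemma cexpD w z : cexp (w + z) = cexp w * cexp z.
Proof.
case: w z => [a b] [c d]; rewrite /cexp /= expRD rmorphM mulrACA; congr (_ * _).
by rewrite /eit cosD sinD; simpc; congr (_ +i* _); rewrite addrC.
Qed.

Lemma cexp0 : cexp 0 = 1.
Proof. by rewrite /cexp /= expR0 mul1r /eit cos0 sin0. Qed.

Lemma cexp_i t : cexp (0 +i* t) = eit t.
Proof. by rewrite /cexp /= expR0 mul1r. Qed.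

Let err_cvg {T : Type} {F : set_system T} {FF : Filter F} (u v w x : T -> R) :
  u @ F --> (1 : R) -> v @ F --> (1 : R) -> w @ F --> (0 : R) -> x @ F --> (1 : R) ->
  (`|u t - 1| + v t * `|w t| + `|v t * x t - 1|) @[t --> F] --> (0 : R).
Proof.
move=> cu cv cw cx.
have -> : (0 : R) = `|1 - 1 : R| + 1 * `|0 : R| + `|1 * 1 - 1 : R|.
  by rewrite mulr1 subrr normr0 mulr0 !addr0.
apply: cvgD; first apply: cvgD.
- by apply: cvg_norm; apply: cvgB; [exact: cu|exact: cvg_cst].
- by apply: cvgM => //; exact: cvg_norm.
- apply: cvg_norm; apply: cvgB; last exact: cvg_cst.
  by apply: cvgM.
Qed.

(** With a and b the real and imaginary parts of h, both components of
    cexp h - 1 - h are combinations of a and b whose coefficients, expressed by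
    the difference quotients at 0 of exp, cos and sin, tend to 0. *)
Lemma cdiff_cexp0 : cdiff cexp 0.
Proof.
have [al [alE alc al0]] := (is_derive1_caratheodory _ _ _).1 (is_derive_expR (0 : R)).
have [be [beE bec be0]] := (is_derive1_caratheodory _ _ _).1 (is_derive_cos (0 : R)).
have [ga [gaE gac ga0]] := (is_derive1_caratheodory _ _ _).1 (is_derive_sin (0 : R)).
pose err (h : C) : R := `|al (complex.Re h) - 1| +
  expR (complex.Re h) * `|be (complex.Im h)| +
  `|expR (complex.Re h) * ga (complex.Im h) - 1|.
have errE h : h != 0 -> cmod ((cexp h - 1) / h - 1) <= err h.
  move=> h0.
  have -> : (cexp h - 1) / h - 1 = (cexp h - 1 - h) / h by field.
  rewrite cmodM cmodV ler_pdivrMr ?cmod_gt0 //.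
  move: h0 (normr_Re_cmod h) (normr_Im_cmod h); rewrite /err.
  case: h => a b _ /= ha hb.
  have := alE a; have := beE b; have := gaE b.
  rewrite expR0 cos0 sin0 !subr0 => sE cE eE.
  have eE' : expR a = 1 + al a * a by rewrite -eE addrC subrK.
  have cE' : cos b = 1 + be b * b by rewrite -cE addrC subrK.
  have -> : cexp (a +i* b) - 1 - (a +i* b) =
     ((al a - 1) * a + expR a * be b * b) +i* ((expR a * ga b - 1) * b).
    rewrite /cexp /eit /= sE; simpc; congr (_ +i* _).
    + by rewrite cE' mulrDr mulr1 {1}eE'; ring.
    + by ring.
  apply: le_trans (cmod_le_ReIm _) _ => /=.
  apply: (@le_trans _ _ (`|al a - 1| * `|a| + expR a * `|be b| * `|b| +
    `|expR a * ga b - 1| * `|b|)).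
    rewrite normrM lerD2r; apply: le_trans (ler_normD _ _) _.
    by rewrite !normrM (ger0_norm (expR_ge0 _)).
  rewrite !mulrDl; do 2?apply: lerD; rewrite ler_wpM2l //.
have err0 : err h @[h --> (0 : C)] --> 0.
  have cR : (complex.Re h : R) @[h --> (0 : C)] --> (0 : R).
    exact: (@cvg_Re R C (nbhs (0 : C)) (nbhs_filter _) id 0 (@cvg_id _ _)).
  have cI : (complex.Im h : R) @[h --> (0 : C)] --> (0 : R).
    exact: (@cvg_Im R C (nbhs (0 : C)) (nbhs_filter _) id 0 (@cvg_id _ _)).
  have e1 : expR 0 = 1 :> R by exact: expR0.
  rewrite expR0 in al0; rewrite sin0 oppr0 in be0; rewrite cos0 in ga0.
  have ce : expR (complex.Re h) @[h --> (0 : C)] --> (1 : R).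
    by have := cvg_comp _ _ cR (@continuous_expR R 0); rewrite e1.
  have cal : al (complex.Re h) @[h --> (0 : C)] --> (1 : R).
    by have := cvg_comp _ _ cR alc; rewrite al0.
  have cbe : be (complex.Im h) @[h --> (0 : C)] --> (0 : R).
    by have := cvg_comp _ _ cI bec; rewrite be0.
  have cga : ga (complex.Im h) @[h --> (0 : C)] --> (1 : R).
    by have := cvg_comp _ _ cI gac; rewrite ga0.
  exact: (err_cvg cal ce cbe cga).
exists (fun h => if h == 0 then 1 else (cexp h - 1) / h); last first.
  move=> h; rewrite cexp0 subr0; have [->|h0] := eqVneq h 0.
    by rewrite cexp0 mulr0 addr0.
  by rewrite divfK // addrC subrK.
move=> e e0; move/cvgrPdistC_lt : err0 => /(_ e e0)/near_cmodP[d d0 hd].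
exists d => // h /hd; rewrite eqxx subr0; case: ifPn => [_ _|h0 he].
  by rewrite subrr cmod0.
exact: le_lt_trans (errE h h0) (le_lt_trans (ler_norm _) he).
Qed.

Lemma cdiff_cexp w : cdiff cexp w.
Proof.
have [q cq qE] := cdiff_cexp0.
exists (fun y => cexp w * q (y - w)).
  apply: ccontM; first exact: ccont_cst.
  apply: ccont_comp; last by rewrite subrr.
  by apply: ccontB; [exact: ccont_id|exact: ccont_cst].
move=> y; have -> : cexp y = cexp w * cexp (y - w) by rewrite -cexpD addrC subrK.
by rewrite (qE (y - w)) cexp0 subr0; ring.
Qed.

Lemma ccont_cexp w : ccont cexp w.
Proof. exact/cdiff_continuous/cdiff_cexp. Qed.

End ComplexExponential.

(** * Goursat's theorem on rectangles *)

Section IntervalIntegral.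
Context {R : realType}.
Local Notation mu := (@lebesgue_measure R).
Implicit Types (p q : R -> R) (a b c : R).

Definition itv_int a b p : R := \int[mu]_(x in `[a, b]) p x.

Lemma continuous_integrable_itv a b p : continuous p ->
  mu.-integrable `[a, b] (EFin \o p).
Proof.
move=> cp; apply: continuous_compact_integrable; first exact: segment_compact.
exact: continuous_subspaceT.
Qed.

Lemma itv_int_cat a b c p : continuous p -> a <= c -> c <= b ->
  itv_int a b p = itv_int a c p + itv_int c b p.
Proof.
move=> cp ac cb; rewrite /itv_int.
have := @Rintegral_itvB R p (BLeft a) (BRight b) c (continuous_integrable_itv a b cp).
rewrite !bnd_simp => /(_ ac cb) h; apply/eqP.
rewrite [X in _ == X]addrC -subr_eq h; apply/eqP/Rintegral_itv_obnd_cbnd.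
apply: integrableS (continuous_integrable_itv c b cp) => //.
exact: subset_itv_oc_cc.
Qed.

Lemma itv_intB a b p q : continuous p -> continuous q ->
  itv_int a b (fun x => p x - q x) = itv_int a b p - itv_int a b q.
Proof.
by move=> cp cq; rewrite /itv_int RintegralB //; exact: continuous_integrable_itv.
Qed.

Lemma itv_int_near_cst a b k e p : continuous p -> a <= b ->
  (forall x, a <= x <= b -> `|p x - k| <= e) ->
  `|itv_int a b p - k * (b - a)| <= e * (b - a).
Proof.
move=> cp ab pe.
have cst_int (r : R) : itv_int a b (fun=> r) = r * (b - a).
  rewrite /itv_int Rintegral_cst //= lebesgue_measure_itv /= lte_fin.
  by move: ab; rewrite le_eqVlt => /predU1P[->|->]; rewrite ?ltxx ?subrr ?mulr0.
have ck (r : R) : continuous (fun _ : R => r) by move=> x; exact: cvg_cst.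
rewrite ler_norml; apply/andP; split.
  rewrite lerBrDr -mulNr -mulrDl -cst_int addrC.
  rewrite /itv_int; apply: le_Rintegral => //; try exact: continuous_integrable_itv.
  by move=> x /=; rewrite in_itv /= => /pe; rewrite ler_norml => /andP[]; lra.
rewrite lerBlDr -mulrDl -cst_int.
rewrite /itv_int; apply: le_Rintegral => //; try exact: continuous_integrable_itv.
by move=> x /=; rewrite in_itv /= => /pe; rewrite ler_norml => /andP[]; lra.
Qed.

End IntervalIntegral.

Section Bisection.
Context {R : realType}.

Lemma nested_intervals (x : R ^nat) (w : R) : 0 <= w ->
  (forall k, x k <= x k.+1) ->
  (forall k, x k.+1 + w / 2 ^+ k.+1 <= x k + w / 2 ^+ k) ->
  exists p, forall k, x k <= p <= x k + w / 2 ^+ k.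
Proof.
move=> w0 xup xdn.
have up := (nondecreasing_seqP x).1 xup.
pose y k := x k + w / 2 ^+ k.
have dn := (nonincreasing_seqP y).1 xdn.
have xy k : x k <= y k by rewrite /y lerDl divr_ge0 // exprn_ge0.
have ubx k : ubound (range x) (y k).
  move=> _ [j _ <-]; have [jk|/ltnW kj] := leqP j k.
    exact: le_trans (up _ _ jk) (xy k).
  exact: le_trans (xy j) (dn _ _ kj).
exists (sup (range x)) => k; apply/andP; split.
  by apply: ub_le_sup; [exists (y 0%N); exact: ubx|exists k].
by apply: ge_sup; [exists (x 0%N), 0%N|exact: ubx].
Qed.

Lemma half_pow_small (w d : R) : 0 <= w -> 0 < d -> exists k, w / 2 ^+ k < d.
Proof.
move=> w0 d0; exists (Num.bound (w / d)).
rewrite ltr_pdivrMr ?exprn_gt0 // mulrC -ltr_pdivrMr //.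
apply: lt_trans (archi_boundP _) _; first by rewrite divr_ge0 // ltW.
by rewrite -natrX ltr_nat ltn_expl.
Qed.

Implicit Types Phi : R -> R -> R -> R -> R.

(** Goursat's bisection: one of the four quarters of a rectangle carries at least
    a quarter of |Phi|, and the nested rectangles obtained in this way contradict
    the quadratic smallness of Phi at their common point. *)
Lemma bisection_zero Phi (a b c d : R) : a <= b -> c <= d ->
    (forall a m b c d, a <= m -> m <= b -> c <= d ->
      Phi a b c d = Phi a m c d + Phi m b c d) ->
    (forall a b c m d, a <= b -> c <= m -> m <= d ->
      Phi a b c d = Phi a b c m + Phi a b m d) ->
    (forall x y e, a <= x <= b -> c <= y <= d -> 0 < e ->
      exists2 r, 0 < r & forall a' b' c' d', a' <= x <= b' -> c' <= y <= d' ->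
        (b' - a') + (d' - c') < r ->
        `|Phi a' b' c' d'| <= e * ((b' - a') + (d' - c')) ^+ 2) ->
  Phi a b c d = 0.
Proof.
move=> ab cd PhiH PhiV small; apply/eqP; apply: contraT; rewrite -normr_gt0.
set eta := `|_| => eta0.
pose w := b - a; pose h := d - c.
have w0 : 0 <= w by rewrite subr_ge0.
have h0 : 0 <= h by rewrite subr_ge0.
pose Q k (z : R * R) :=
  [/\ a <= z.1, z.1 + w / 2 ^+ k <= b, c <= z.2, z.2 + h / 2 ^+ k <= d &
   eta <= 4 ^+ k * `|Phi z.1 (z.1 + w / 2 ^+ k) z.2 (z.2 + h / 2 ^+ k)|].
have halfE (t : R) k : t / 2 ^+ k = t / 2 ^+ k.+1 + t / 2 ^+ k.+1.
  have k0 : (2 : R) ^+ k != 0 by rewrite expf_neq0.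
  by rewrite exprS; field.
have step k z : Q k z -> exists z', [/\ Q k.+1 z',
    z.1 <= z'.1, z'.1 + w / 2 ^+ k.+1 <= z.1 + w / 2 ^+ k,
    z.2 <= z'.2 & z'.2 + h / 2 ^+ k.+1 <= z.2 + h / 2 ^+ k].
  case: z => x y [] /=; rewrite (halfE w) (halfE h) !addrA.
  set s := w / _; set t := h / _ => ax xb cy yd.
  have s0 : 0 <= s by rewrite divr_ge0 // exprn_ge0.
  have t0 : 0 <= t by rewrite divr_ge0 // exprn_ge0.
  rewrite (PhiH x (x + s)) ?lerDl // -?addrA ?lerDl ?addr_ge0 //.
  rewrite !addrA (PhiV _ _ y (y + t)) ?lerDl //.
  rewrite (PhiV (x + s) _ y (y + t)) ?lerDl //.
  set P1 := Phi x _ y _; set P2 := Phi x _ (y + t) _.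
  set P3 := Phi _ _ y _; set P4 := Phi _ _ _ _ => etale.
  have four : [|| eta <= 4 ^+ k.+1 * `|P1|, eta <= 4 ^+ k.+1 * `|P2|,
      eta <= 4 ^+ k.+1 * `|P3| | eta <= 4 ^+ k.+1 * `|P4|].
    apply: contraT; rewrite !negb_or -!ltNge exprSr => /and4P[h1 h2 h3 h4].
    have p4 : 0 < (4 : R) ^+ k by rewrite exprn_gt0.
    have tri : `|P1 + P2 + (P3 + P4)| <= `|P1| + `|P2| + (`|P3| + `|P4|).
      apply: le_trans (ler_normD _ _) _; apply: lerD; exact: ler_normD.
    have tri4 : 4 ^+ k * `|P1 + P2 + (P3 + P4)| <= 4 ^+ k * `|P1| +
        4 ^+ k * `|P2| + (4 ^+ k * `|P3| + 4 ^+ k * `|P4|).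
      by rewrite -!mulrDr ler_pM2l.
    have fE u : (4 : R) ^+ k * 4 * u = 4 * (4 ^+ k * u).
      by rewrite (mulrC _ 4) mulrA.
    move: h1 h2 h3 h4 (le_trans etale tri4); rewrite !fE.
    move: (4 ^+ k * `|P1|) (4 ^+ k * `|P2|) (4 ^+ k * `|P3|) (4 ^+ k * `|P4|).
    by move=> *; lra.
  case/or4P: four => hk.
  - by exists (x, y); split; [split|..]; rewrite /= -?/s -?/t //; lra.
  - by exists (x, y + t); split; [split|..]; rewrite /= -?/s -?/t //; lra.
  - by exists (x + s, y); split; [split|..]; rewrite /= -?/s -?/t //; lra.
  - by exists (x + s, y + t); split; [split|..]; rewrite /= -?/s -?/t //; lra.
have Q0 : Q 0%N (a, c).
  by split; rewrite /= ?expr0 ?divr1 ?mul1r ?/w ?/h ?(addrC _ (_ - _)) ?subrK.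
pose z : forall k, {z | Q k z} := nat_rect _ (exist _ _ Q0)
  (fun k zk => let: exist z Qz := zk in
    let: exist z' H := cid (step k z Qz) in exist _ z' (let: And5 H _ _ _ _ := H in H)).
have zS k : [/\ (sval (z k)).1 <= (sval (z k.+1)).1,
    (sval (z k.+1)).1 + w / 2 ^+ k.+1 <= (sval (z k)).1 + w / 2 ^+ k,
    (sval (z k)).2 <= (sval (z k.+1)).2 &
    (sval (z k.+1)).2 + h / 2 ^+ k.+1 <= (sval (z k)).2 + h / 2 ^+ k].
  rewrite /=; case: (z k) => u Qu /=.
  by case: (cid _) => v /= [].
have [x xP] := @nested_intervals (fun k => (sval (z k)).1) w w0
  (fun k => let: And4 H _ _ _ := zS k in H) (fun k => let: And4 _ H _ _ := zS k in H).
have [y yP] := @nested_intervals (fun k => (sval (z k)).2) h h0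
  (fun k => let: And4 _ _ H _ := zS k in H) (fun k => let: And4 _ _ _ H := zS k in H).
have xab : a <= x <= b.
  have [/= _ zb _ _ _] := svalP (z 0%N); have := xP 0%N.
  by rewrite /= expr0 divr1 /w => /andP[h1 h2]; apply/andP; split; lra.
have ycd : c <= y <= d.
  by have := yP 0%N; rewrite /= expr0 divr1 /h => /andP[h1 h2]; apply/andP; split; lra.
have m0 : 0 < 2 * ((w + h) ^+ 2 + 1) by rewrite mulr_gt0 // ltr_wpDl ?sqr_ge0.
have e0 : 0 < eta / (2 * ((w + h) ^+ 2 + 1)) by rewrite divr_gt0.
have [r r0 hr] := small x y _ xab ycd e0.
have [k hk] := half_pow_small (addr_ge0 w0 h0) r0.
have [_ _ _ _] := svalP (z k).
have := hr (sval (z k)).1 ((sval (z k)).1 + w / 2 ^+ k) (sval (z k)).2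
  ((sval (z k)).2 + h / 2 ^+ k) (xP k) (yP k).
rewrite ![_ + _ / _ - _]addrAC !subrr !add0r -mulrDl => /(_ hk) le1.
have p4 : 0 < (4 : R) ^+ k by rewrite exprn_gt0.
move=> /le_trans /(_ (ler_wpM2l (ltW p4) le1)).
have -> : ((w + h) / 2 ^+ k) ^+ 2 = (w + h) ^+ 2 / 4 ^+ k.
  have -> : (4 : R) = 2 ^+ 2 by rewrite expr2 -natrM.
  by rewrite expr_div_n -!exprM mulnC.
have -> : (4 : R) ^+ k * (eta / (2 * ((w + h) ^+ 2 + 1)) *
   ((w + h) ^+ 2 / 4 ^+ k)) = (w + h) ^+ 2 * eta / (2 * ((w + h) ^+ 2 + 1)).
  move: (4 ^+ k) p4 m0 => p p0; move: ((w + h) ^+ 2) => u u0; field.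
  by rewrite (lt0r_neq0 p0) andbT; apply: lt0r_neq0; move: u0; rewrite pmulr_rgt0.
rewrite ler_pdivlMr //; have := sqr_ge0 (w + h); nra.
Qed.

End Bisection.

Section Goursat.
Context {R : realType}.
Local Notation C := R[i].
Implicit Types (E : C -> C) (a b c d x y : R).

Lemma ccont_path E (g : R -> C) : (forall w, ccont E w) ->
  (forall t, g s @[s --> t] --> g t) -> forall t, E (g s) @[s --> t] --> E (g t).
Proof.
move=> cE cg t; apply/cvg_cmodP => e /(cE (g t))[d d0 hd].
by have /cvg_cmodP/(_ d d0) := cg t; apply: filterS => s; exact: hd.
Qed.

Lemma continuous_Re_path E (g : R -> C) : (forall w, ccont E w) ->
  (forall t, g s @[s --> t] --> g t) -> continuous (fun t => complex.Re (E (g t)) : R).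
Proof. by move=> cE cg t; apply: cvg_Re; exact: ccont_path. Qed.

Lemma continuous_Im_path E (g : R -> C) : (forall w, ccont E w) ->
  (forall t, g s @[s --> t] --> g t) -> continuous (fun t => complex.Im (E (g t)) : R).
Proof. by move=> cE cg t; apply: cvg_Im; exact: ccont_path. Qed.

Lemma cvg_horizontal c (t : R) : ((s +i* c) : C) @[s --> t] --> ((t +i* c) : C).
Proof. by apply: cvg_complex; [exact: cvg_id|exact: cvg_cst]. Qed.

Lemma cvg_vertical c (t : R) : ((c +i* s) : C) @[s --> t] --> ((c +i* t) : C).
Proof. by apply: cvg_complex; [exact: cvg_cst|exact: cvg_id]. Qed.

(** The imaginary part of the integral of E dw along the boundary of
    [a, b] x [c, d]. *)
Definition rect_int E a b c d : R :=
  itv_int a b (fun x => complex.Im (E (x +i* c)) - complex.Im (E (x +i* d))) +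
  itv_int c d (fun y => complex.Re (E (b +i* y)) - complex.Re (E (a +i* y))).

Section Rectangle.
Variable E : C -> C.
Hypothesis cE : forall w, ccont E w.

Let cH c : continuous (fun x => complex.Im (E (x +i* c)) : R).
Proof. by apply: continuous_Im_path cE _ => t; exact: cvg_horizontal. Qed.

Let cV a : continuous (fun y => complex.Re (E (a +i* y)) : R).
Proof. by apply: continuous_Re_path cE _ => t; exact: cvg_vertical. Qed.

Let cB (p q : R -> R) : continuous p -> continuous q -> continuous (fun x => p x - q x).
Proof. by move=> cp cq x; apply: cvgB; [exact: cp|exact: cq]. Qed.

Lemma rect_int_horizontal a m b c d : a <= m -> m <= b -> c <= d ->
  rect_int E a b c d = rect_int E a m c d + rect_int E m b c d.
Proof.
move=> am mb cd; rewrite /rect_int (itv_int_cat (cB (@cH c) (@cH d)) am mb).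
by rewrite !(itv_intB _ _ (@cV _) (@cV _)); ring.
Qed.

Lemma rect_int_vertical a b c m d : a <= b -> c <= m -> m <= d ->
  rect_int E a b c d = rect_int E a b c m + rect_int E a b m d.
Proof.
move=> ab cm md; rewrite /rect_int (itv_int_cat (cB (@cV b) (@cV a)) cm md).
by rewrite !(itv_intB _ _ (@cH _) (@cH _)); ring.
Qed.

(** Up to an error E is affine near the point, and the boundary integral of an
    affine function vanishes. *)
Lemma rect_int_small x y e : cdiff E (x +i* y) -> 0 < e ->
  exists2 r, 0 < r & forall a b c d, a <= x <= b -> c <= y <= d ->
    (b - a) + (d - c) < r ->
    `|rect_int E a b c d| <= e * ((b - a) + (d - c)) ^+ 2.
Proof.
set p := _ +i* _ => -[q cq qE] e0.
have e20 : 0 < e / 2 by rewrite divr_gt0.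
have [r r0 hr] := cq _ e20; exists r => // a b c d /andP[ax xb] /andP[cy yd].
set L := _ + _ => Lr.
have ab : a <= b := le_trans ax xb.
have cd : c <= d := le_trans cy yd.
pose err w := (q w - q p) * (w - p).
have errE w : E w = E p + q p * (w - p) + err w by rewrite qE /err; ring.
have errL u v : a <= u <= b -> c <= v <= d -> cmod (err (u +i* v)) <= e / 2 * L.
  move=> /andP[au ub] /andP[cv vd].
  have hL : cmod (u +i* v - p) <= L.
    apply: le_trans (cmod_le_ReIm _) _; rewrite /= /L; apply: lerD.
      by rewrite ler_norml; apply/andP; split; lra.
    by rewrite ler_norml; apply/andP; split; lra.
  rewrite cmodM; apply: ler_pM => //; try exact: cmod_ge0.
  by apply/ltW/hr; exact: le_lt_trans hL Lr.
have h1 : `|itv_int a b (fun x => complex.Im (E (x +i* c)) - complex.Im (E (x +i* d))) -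
    (complex.Re (q p) * (c - d)) * (b - a)| <= e * L * (b - a).
  apply: itv_int_near_cst => // [|u hu]; first by apply: cB; [exact: cH|exact: cH].
  have := le_trans (normr_Im_cmod _) (errL u c hu _); rewrite lexx cd => /(_ isT).
  have := le_trans (normr_Im_cmod _) (errL u d hu _); rewrite lexx cd => /(_ isT).
  rewrite (errE (u +i* c)) (errE (u +i* d)) !ImD !ImM !ImD !ReD !ImN !ReN /=.
  rewrite !ler_norml => /andP[? ?] /andP[? ?]; apply/andP; split; lra.
have h2 : `|itv_int c d (fun y => complex.Re (E (b +i* y)) - complex.Re (E (a +i* y))) -
    (complex.Re (q p) * (b - a)) * (d - c)| <= e * L * (d - c).
  apply: itv_int_near_cst => // [|v hv]; first by apply: cB; [exact: cV|exact: cV].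
  have := fun h => le_trans (normr_Re_cmod _) (errL b v h hv).
  rewrite lexx ab => /(_ isT).
  have := fun h => le_trans (normr_Re_cmod _) (errL a v h hv).
  rewrite lexx ab => /(_ isT).
  rewrite (errE (b +i* v)) (errE (a +i* v)) !ReD !ReM !ReD !ImD !ImN !ReN /=.
  rewrite !ler_norml => /andP[? ?] /andP[? ?]; apply/andP; split; lra.
rewrite /rect_int; move: h1 h2; set I1 := itv_int _ _ _; set I2 := itv_int _ _ _.
rewrite expr2 mulrA => h1 h2.
have -> : I1 + I2 = (I1 - complex.Re (q p) * (c - d) * (b - a)) +
  (I2 - complex.Re (q p) * (b - a) * (d - c)) by ring.
apply: le_trans (ler_normD _ _) _.
have -> : e * L * L = e * L * (b - a) + e * L * (d - c) by rewrite -mulrDr.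
exact: lerD.
Qed.

Lemma goursat a b c d : a <= b -> c <= d ->
  (forall x y, a <= x <= b -> c <= y <= d -> cdiff E (x +i* y)) ->
  rect_int E a b c d = 0.
Proof.
move=> ab cd dE; apply: bisection_zero => // [*|*|x y e hx hy e0].
- exact: rect_int_horizontal.
- exact: rect_int_vertical.
- exact: rect_int_small (dE _ _ hx hy) e0.
Qed.

Lemma periodic_int_cst (T : R) a b : 0 <= T -> a <= b ->
  (forall x, E (x +i* T) = E (x +i* 0)) ->
  (forall x y, a <= x <= b -> cdiff E (x +i* y)) ->
  itv_int 0 T (fun y => complex.Re (E (a +i* y))) =
  itv_int 0 T (fun y => complex.Re (E (b +i* y))).
Proof.
move=> T0 ab ET dE; have := goursat ab T0 (fun x y hx _ => dE x y hx).
rewrite /rect_int (itv_intB _ _ (@cV _) (@cV _)).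
have -> : (fun x => complex.Im (E (x +i* 0)) - complex.Im (E (x +i* T))) = fun=> 0.
  by apply/funext => x; rewrite ET subrr.
rewrite /itv_int Rintegral_cst //= mul0r add0r => /eqP; rewrite subr_eq0.
by move/eqP.
Qed.

End Rectangle.
End Goursat.

(** * The mean value estimate in the disc *)

Section DiscMean.
Context {R : realType}.
Local Notation C := R[i].
Local Notation mu := (@lebesgue_measure R).
Implicit Types (F : C -> C) (z w : C).

Lemma cvg_eit (t : R) : eit s @[s --> t] --> eit t.
Proof.
by apply: cvg_complex; [exact: continuous_cos|exact: continuous_sin].
Qed.

Lemma constant_endpoints (g : R -> R) (a b k : R) : a < b ->
  {for a, continuous g} -> {for b, continuous g} ->
  (forall s, a < s < b -> g s = k) -> g a = k /\ g b = k.
Proof.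
move=> ab cga cgb gk; split; apply/eqP; rewrite -subr_eq0 -normr_le0;
  apply/ler_addgt0Pr => e e0.
  rewrite add0r; have /cvgrPdist_lt/(_ e e0) := cga.
  move=> /nbhs_normP[d /= d0 hd].
  pose s := Num.min (a + d / 2) ((a + b) / 2).
  have sab : a < s < b.
    rewrite lt_min gt_min; apply/andP; split; last by apply/orP; right; lra.
    by apply/andP; split; lra.
  rewrite -(gk s sab); apply/ltW/hd => /=; rewrite distrC.
  rewrite ger0_norm; last by case/andP: sab; lra.
  have : s <= a + d / 2 by rewrite ge_min lexx.
  by move: d0; rewrite /=; lra.
rewrite add0r; have /cvgrPdist_lt/(_ e e0) := cgb.
move=> /nbhs_normP[d /= d0 hd].
pose s := Num.max (b - d / 2) ((a + b) / 2).
have sab : a < s < b.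
  rewrite gt_max lt_max; apply/andP; split; first by apply/orP; right; lra.
  by apply/andP; split; lra.
rewrite -(gk s sab); apply/ltW/hd => /=.
rewrite ger0_norm; last by case/andP: sab; lra.
have : b - d / 2 <= s by rewrite le_max lexx.
by move: d0; rewrite /=; lra.
Qed.

(** I stands for the integral of a function over the circles of radius e^s, where
    differentiability may fail on the circle of radius rho only.  It is 0 for
    e^s < rho, being constant there and small near -oo; by continuity it is 0 at
    ln rho, hence on the other side, where it is constant as well. *)
Lemma continued_zero (I : R -> R) (K rho : R) :
    (forall s, s <= 0 -> {for s, continuous I}) ->
    0 <= rho < 1 -> (forall s, s <= 0 -> `|I s| <= K * expR s) ->
    (forall s t, s <= t -> t < 0 -> (forall x, s <= x <= t -> expR x != rho) ->
      I s = I t) ->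
  I 0 = 0.
Proof.
move=> cI /andP[r0 r1] IK Icst.
have K0 : 0 <= K.
  by have := IK 0 (lexx 0); rewrite expR0 mulr1; apply: le_trans.
have left0 m : m <= 0 -> (forall x, x < m -> expR x != rho) ->
    forall s, s < m -> I s = 0.
  move=> m0 hm s sm; apply/eqP; rewrite -normr_le0; apply/ler_addgt0Pr => e e0.
  rewrite add0r; pose u := Num.min s (ln (e / (K + 1))).
  have us : u <= s by rewrite ge_min lexx.
  have K1 : 0 < K + 1 by rewrite ltr_wpDl.
  rewrite -(Icst u s us); last 2 first.
  - exact: lt_le_trans sm m0.
  - by move=> x /andP[_ xs]; apply: hm; exact: le_lt_trans xs sm.
  have u0 : u <= 0 by apply: le_trans us (ltW (lt_le_trans sm m0)).
  apply: le_trans (IK u u0) _.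
  have : expR u <= e / (K + 1).
    rewrite -[leRHS]lnK ?posrE ?divr_gt0 // ler_expR.
    by rewrite ge_min lexx orbT.
  rewrite ler_pdivlMr // => h; apply: le_trans _ h.
  by have := expR_ge0 u; nra.
have [rho0|rho0] := eqVneq rho 0.
  have := left0 0 (lexx 0) => /(_ _) h.
  apply: (proj2 (@constant_endpoints I (-1) 0 0 _ _ _ _)) => [|||s /andP[_ s0]].
  - by rewrite oppr_lt0.
  - by apply: cI; rewrite oppr_le0.
  - exact: cI.
  by apply: h => // x _; rewrite rho0 gt_eqF ?expR_gt0.
have rp : 0 < rho by rewrite lt_neqAle r0 eq_sym rho0.
have lr : ln rho < 0 by rewrite ln_lt0 // rp.
have hne x : x != ln rho -> expR x != rho.
  by apply: contraNneq => <-; rewrite expRK.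
have hI s : s < ln rho -> I s = 0.
  by apply: left0 (ltW lr) _ _ => x xl; apply: hne; rewrite lt_eqF.
have mid s t : ln rho < s -> s <= t -> t < 0 -> I s = I t.
  move=> ls st t0; apply: Icst => // x /andP[sx _]; apply: hne.
  by rewrite gt_eqF // (lt_le_trans ls sx).
have [|||s /andP[ls s0]|_ I0] := @constant_endpoints I (ln rho - 1) (ln rho) 0.
- lra.
- by apply: cI; lra.
- by apply: cI; lra.
- exact: hI.
have [||s /andP[ls s0]|Il ->] := @constant_endpoints I (ln rho) 0 (I (ln rho / 2)) lr.
- by apply: cI; lra.
- exact: cI.
- have [st|ts] := leP s (ln rho / 2); first by apply: mid => //; lra.
  by apply/esym/mid => //; lra.
by rewrite -Il.
Qed.

End DiscMean.

Section CauchyEstimate.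
Context {R : realType}.
Local Notation C := R[i].
Local Notation mu := (@lebesgue_measure R).
Implicit Types (F : C -> C) (z w : C).

(** Near z the quotient is controlled by continuity, elsewhere by the bound on
    F. *)
Lemma bounded_difference_quotient F q z (B : R) : ccont q z ->
  (forall y, F y = F z + q y * (y - z)) -> (forall w, cmod (F w) <= B) ->
  exists K, forall w, cmod (q w) <= K.
Proof.
move=> cq qE FB; have [d d0 hd] := cq 1 ltr01.
have B0 : 0 <= B by exact: le_trans (cmod_ge0 _) (FB 0).
exists (cmod (q z) + 1 + 2 * B / d) => w.
have t0 : 0 <= 2 * B / d by rewrite divr_ge0 ?mulr_ge0 // ltW.
have [wd|dw] := ltP (cmod (w - z)) d.
  have := cmodD (q w - q z) (q z); rewrite subrK; have := hd w wd; lra.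
have wz : 0 < cmod (w - z) by exact: lt_le_trans dw.
apply: (@le_trans _ _ (2 * B / d)); last by have := cmod_ge0 (q z); lra.
rewrite ler_pdivlMr //; apply: (@le_trans _ _ (cmod (q w) * cmod (w - z))).
  by rewrite ler_wpM2l ?cmod_ge0.
rewrite -cmodM; have -> : q w * (w - z) = F w - F z.
  by apply/esym; rewrite [F w]qE addrC addKr.
by have := cmodD (F w) (- F z); rewrite cmodN; have := FB w; have := FB z; lra.
Qed.

Lemma ccont_difference_quotient F q z w : (forall w, ccont F w) -> ccont q z ->
  (forall y, F y = F z + q y * (y - z)) -> ccont q w.
Proof.
move=> cF cq qE; have [->//|wz] := eqVneq w z.
have wz0 : 0 < cmod (w - z) by rewrite cmod_gt0 subr_eq0.
apply: (@ccont_near _ (fun y => (F y - F z) / (y - z)) _ _ _ wz0).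
  move=> y yw; rewrite [F y]qE addrC addKr mulfK // subr_eq0.
  by apply: contraTneq yw => ->; rewrite cmodC ltxx.
apply: ccontM; first by apply: ccontB => //; exact: ccont_cst.
apply: ccontV; first by rewrite subr_eq0.
by apply: ccontB; [exact: ccont_id|exact: ccont_cst].
Qed.

Let T : R := 2 * pi.

Let T0 : 0 < T. Proof. by rewrite /T mulr_gt0 // pi_gt0. Qed.

Lemma continuous_circle_integrals (E : C -> C) (K : R) : (forall w, ccont E w) ->
  (forall s y, s < 1 -> cmod (E (s +i* y)) <= K) ->
  forall s, s < 1 -> {for s, continuous
    (fun s : R => itv_int 0 T (fun y => complex.Re (E (s +i* y))))}.
Proof.
move=> cE EK s s1.
have cf y : continuous (fun x : R => complex.Re (E (x +i* y)) : R).
  by apply: continuous_Re_path cE _ => t; exact: cvg_horizontal.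
have cg x : continuous (fun y : R => complex.Re (E (x +i* y)) : R).
  by apply: continuous_Re_path cE _ => t; exact: cvg_vertical.
have sI : s \in `]s - 1, 1[.
  by rewrite in_itv /= s1 andbT; lra.
apply: (@continuity_under_integral R _ _ mu (fun x y => complex.Re (E (x +i* y)))
  `[0, T]%classic _ (s - 1) 1 _ _ (fun=> K) _ _ s _) => //.
- by move=> x _; exact: continuous_integrable_itv.
- by apply: aeW => y _ x _; exact: cf.
- by apply: continuous_integrable_itv => x; exact: cvg_cst.
- move=> x; rewrite /= in_itv /= => /andP[_ x1]; apply: aeW => y _.
  exact: le_trans (normr_Re_cmod _) (EK _ _ x1).
- by rewrite inE.
Qed.

(** Cauchy's theorem for w (F w - F z) / (w - z), whose value at 0 is 0. *)
Lemma cauchy_mean F q (B : R) z : (forall w, ccont F w) ->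
  (forall w, cmod w < 1 -> cdiff F w) -> (forall w, cmod (F w) <= B) ->
  cmod z < 1 -> ccont q z -> (forall y, F y = F z + q y * (y - z)) ->
  itv_int 0 T (fun t => complex.Re (eit t * q (eit t))) = 0.
Proof.
move=> cF dF FB z1 cqz qE.
have cq w : ccont q w by exact: ccont_difference_quotient cF cqz qE.
have [K qK] := bounded_difference_quotient cqz qE FB.
have K0 : 0 <= K by exact: le_trans (cmod_ge0 _) (qK 0).
pose G w := w * q w.
pose E w := G (cexp w).
have cG w : ccont G w by apply: ccontM => //; exact: ccont_id.
have cE w : ccont E w by apply: ccont_comp => //; exact: ccont_cexp.
have dG w : cmod w < 1 -> w != z -> cdiff G w.
  move=> w1 wz; apply: cdiffM; first exact: cdiff_id.
  exact: cdiff_difference_quotient wz (dF _ w1) qE.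
have dE w : complex.Re w < 0 -> expR (complex.Re w) != cmod z -> cdiff E w.
  move=> w0 wz; apply: cdiff_comp; first exact: cdiff_cexp.
  apply: dG; first by rewrite cmod_cexp -expR0 ltr_expR.
  by apply: contra_neq wz => <-; rewrite cmod_cexp.
have EK s y : cmod (E (s +i* y)) <= K * expR s.
  by rewrite /E /G cmodM cmod_cexp /= mulrC ler_wpM2r ?expR_ge0.
have Eper x : E (x +i* T) = E (x +i* 0).
  by rewrite /E /cexp /= /eit /T mulr_natl cos2pi sin2pi cos0 sin0.
pose I s := itv_int 0 T (fun y => complex.Re (E (s +i* y))).
have IK s : `|I s| <= (K * T) * expR s.
  have := @itv_int_near_cst R 0 T 0 (K * expR s)
    (fun y => complex.Re (E (s +i* y))) _ (ltW T0).
  rewrite mul0r !subr0 mulrAC; apply.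
    by apply: continuous_Re_path cE _ => t; exact: cvg_vertical.
  by move=> y _; rewrite subr0; apply: le_trans (normr_Re_cmod _) (EK _ _).
suff : I 0 = 0.
  move=> I0; rewrite -[RHS]I0; congr (itv_int 0 T _); apply/funext => t.
  by rewrite /E cexp_i.
apply: (@continued_zero _ I (K * T) (cmod z)).
- move=> s s0; apply: (@continuous_circle_integrals E (K * expR 1)) => //.
    move=> t y t1; apply: le_trans (EK t y) _.
    by rewrite ler_wpM2l // ler_expR ltW.
  exact: le_lt_trans s0 ltr01.
- by rewrite cmod_ge0.
- by move=> s _; exact: IK.
- move=> s t st t0 ne; apply: periodic_int_cst => //; first exact: ltW.
  move=> x y /andP[sx xt]; apply: dE => /=; first exact: le_lt_trans t0.
  by apply: ne; rewrite sx.
Qed.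

End CauchyEstimate.

Section DiscMeanInequality.
Context {R : realType}.
Local Notation C := R[i].
Local Notation mu := (@lebesgue_measure R).
Implicit Types (F : C -> C) (z w : C).

(** On the unit circle the Cauchy kernel v = zeta / (zeta - z) lies in the half
    plane Re v >= 1/2, since |v - 1| = |v| |z| <= |v|. *)
Lemma cauchy_kernel (zeta z : C) : cmod zeta = 1 -> cmod z < 1 ->
  2^-1 <= complex.Re (zeta / (zeta - z)) /\
  cmod (zeta / (zeta - z)) <= (1 - cmod z)^-1.
Proof.
move=> ze z1; set v := zeta / _.
have zz : zeta - z != 0.
  by rewrite subr_eq0; apply: contraTneq z1 => <-; rewrite ze ltxx.
have vE : v * (zeta - z) = zeta by rewrite /v divfK.
have le1 : 1 - cmod z <= cmod (zeta - z).
  by have := cmodD (zeta - z) z; rewrite subrK ze; lra.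
have p1 : 0 < 1 - cmod z by rewrite subr_gt0.
split; last first.
  rewrite -[leRHS]mul1r ler_pdivlMr //.
  apply: le_trans (ler_wpM2l (cmod_ge0 v) le1) _.
  by rewrite -cmodM vE ze.
have : cmod (v - 1) <= cmod v.
  have -> : cmod (v - 1) = cmod v * cmod z.
    have -> : v - 1 = v * (z / zeta).
      have z0 : zeta != 0 by rewrite -cmod_gt0 ze.
      by apply: (mulIf z0); rewrite mulrA divfK // mulrBl mul1r -[in X in _ - X]vE; ring.
    by rewrite (cmodM v) (cmodM z) (cmodV zeta) ze invr1 mulr1.
  by apply: ler_piMr; [exact: cmod_ge0|exact: ltW].
move=> h; have : cmod (v - 1) ^+ 2 <= cmod v ^+ 2.
  by rewrite lerXn2r ?nnegrE ?cmod_ge0.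
by rewrite !cmod_sqr ReD ImD ReN ImN /= oppr0 addr0; lra.
Qed.

(** After a rotation that makes F z nonnegative, the real part of
    (F zeta - F z) zeta / (zeta - z) is at most
    |F zeta| / (1 - |z|) - |F z| / 2, and its mean is 0. *)
Lemma disc_mean F (B : R) z : (forall w, ccont F w) ->
  (forall w, cmod w < 1 -> cdiff F w) -> (forall w, cmod (F w) <= B) ->
  cmod z < 1 ->
  ((cmod (F z))%:E <= (2 / (1 - cmod z))%:E *
    \int[uniform_prob (@pi2_gt0 R)]_t (cmod (F (eit t)))%:E)%E.
Proof.
move=> cF dF FB z1.
have T0 : 0 < 2 * pi :> R := pi2_gt0.
have p1 : 0 < 1 - cmod z by rewrite subr_gt0.
have [c c1 cE] := unimodular (F z).
pose F1 w := c * F w.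
have F1E w : cmod (F1 w) = cmod (F w) by rewrite cmodM c1 mul1r.
have cF1 w : ccont F1 w by apply: ccontM => //; exact: ccont_cst.
have dF1 w : cmod w < 1 -> cdiff F1 w.
  by move=> w1; apply: cdiffM; [exact: cdiff_cst|exact: dF].
have F1B w : cmod (F1 w) <= B by rewrite F1E.
have [q cq qE] := dF1 z z1.
have I0 := cauchy_mean cF1 dF1 F1B z1 cq qE.
have cqe w : ccont q w by exact: ccont_difference_quotient cF1 cq qE.
pose g t := complex.Re (eit t * q (eit t)) : R.
have cg : continuous g.
  apply: (@continuous_Re_path R (fun w => w * q w) eit) => [w|t]; last exact: cvg_eit.
  by apply: ccontM => //; exact: ccont_id.
pose p t := cmod (F (eit t)) : R.
have cp : continuous p.
  by move=> t; apply: cvg_cmod; apply: ccont_path => //; exact: cvg_eit.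
pose k := (1 - cmod z)^-1.
have k0 : 0 < k by rewrite invr_gt0.
have cpk : continuous (fun t => p t * k).
  by move=> t; apply: cvgM; [exact: cp|exact: cvg_cst].
have low t : cmod (F z) / 2 <= p t * k - g t.
  have [h1 h2] := cauchy_kernel (cmod_eit t) z1.
  have z0 : eit t - z != 0.
    by rewrite subr_eq0; apply: contraTneq z1 => <-; rewrite cmod_eit ltxx.
  have gE : eit t * q (eit t) = F1 (eit t) * (eit t / (eit t - z)) -
      (cmod (F z))%:C * (eit t / (eit t - z)).
    rewrite -mulrBl -cE -/(F1 z); have -> : F1 (eit t) - F1 z = q (eit t) * (eit t - z).
      by rewrite [F1 (eit t)]qE addrC addKr.
    by field.
  rewrite /g gE ReD ReN [complex.Re ((_)%:C * _)]ReM /= mul0r subr0.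
  have h3 := le_trans (Re_le_cmod (F1 (eit t) * (eit t / (eit t - z)))) (lexx _).
  rewrite cmodM F1E -/(p t) in h3.
  have h4 : p t * cmod (eit t / (eit t - z)) <= p t * k.
    by rewrite ler_wpM2l ?cmod_ge0.
  have := cmod_ge0 (F z); nra.
have main : cmod (F z) / 2 * (2 * pi) <= itv_int 0 (2 * pi) p * k.
  have -> : itv_int 0 (2 * pi) p * k = itv_int 0 (2 * pi) (fun t => p t * k - g t).
    rewrite itv_intB // I0 subr0 /itv_int RintegralZr //.
    exact: continuous_integrable_itv.
  have -> : cmod (F z) / 2 * (2 * pi) = itv_int 0 (2 * pi) (fun=> cmod (F z) / 2).
    rewrite /itv_int Rintegral_cst //= lebesgue_measure_itv /= lte_fin T0.
    by rewrite /= subr0.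
  apply: le_Rintegral => //.
  - by apply: continuous_integrable_itv => t; exact: cvg_cst.
  - by apply: continuous_integrable_itv => t; apply: cvgB; [exact: cpk|exact: cg].
rewrite integral_uniform; last 2 first.
- apply/measurable_EFinP; apply: continuous_measurable_fun; exact: cp.
- by move=> t; rewrite lee_fin cmod_ge0.
have -> : (\int[mu]_(x in `[0%R, (2 * pi)%R]) (cmod (F (eit x)))%:E =
    (itv_int 0 (2 * pi) p)%:E)%E.
  rewrite /itv_int /Rintegral fineK //.
  by apply: integrable_fin_num => //; exact: continuous_integrable_itv.
rewrite -!EFinM lee_fin subr0.
have -> : 2 / (1 - cmod z) * ((2 * pi)^-1 * itv_int 0 (2 * pi) p) =
   itv_int 0 (2 * pi) p * k / pi.
  rewrite /k; move: (itv_int _ _ _) => I; move: (@pi R) (pi_gt0 R) => P P0; field.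
  by rewrite !lt0r_neq0.
rewrite ler_pdivlMr ?pi_gt0 //.
by move: main; rewrite mulrA divfK.
Qed.

End DiscMeanInequality.

(** * The mean value estimate in the polydisc *)

Section TorusMeasurability.
Context {R : realType}.
Local Notation C := R[i].

Definition mcont n (F : 'rV[C]_n -> C) := forall (w : 'rV[C]_n) (e : R), 0 < e ->
  exists2 d : R, 0 < d & forall y : 'rV[C]_n, (forall j, cmod (y 0 j - w 0 j) < d) ->
    cmod (F y - F w) < e.

Lemma measurable_floor_tuple n (N : R) (g : n.-tuple int -> R) : 0 < N ->
  measurable_fun setT (fun t : n.-tuple (measurableTypeR R) =>
    g (map_tuple (fun x : R => Num.floor (x * N)) t)).
Proof.
move=> N0 _ B mB; rewrite setTI.
pose A (k : n.-tuple int) (i : 'I_n) := [set t : n.-tuple (measurableTypeR R) |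
  (tnth k i)%:~R / N <= tnth t i < (tnth k i + 1)%:~R / N].
have mA k i : measurable (A k i).
  have -> : A k i = setT `&` (fun t => tnth t i) @^-1`
      `[(tnth k i)%:~R / N, (tnth k i + 1)%:~R / N[%classic.
    by rewrite setTI; apply/seteqP; split => t; rewrite /A /= in_itv.
  have mi := measurable_itv `[(tnth k i)%:~R / N, (tnth k i + 1)%:~R / N[.
  by have := measurable_tnth i measurableT mi.
have AP k t : (forall i, A k i t) <-> map_tuple (fun x : R => Num.floor (x * N)) t = k.
  split=> [Akt|<- i].
    apply: eq_from_tnth => i; rewrite tnth_map; apply/eqP; rewrite floor_eq.
    by have := Akt i; rewrite /A /= ler_pdivrMr // ltr_pdivlMr.
  by rewrite /A /= tnth_map ler_pdivrMr // ltr_pdivlMr // floor_itv.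
have -> : (fun t => g (map_tuple (fun x : R => Num.floor (x * N)) t)) @^-1` B =
    \bigcup_k (if `[< B (g k) >] then \bigcap_i A k i else set0).
  apply/seteqP; split => [t /= Bt|t [k _]].
    exists (map_tuple (fun x : R => Num.floor (x * N)) t) => //; rewrite asboolT //.
    by move=> i _; apply: (AP _ _).2.
  case: asboolP => // Bk h /=.
  by rewrite ((AP k t).1 (fun i => h i I)).
apply: countable_bigcupT_measurable; first exact: countableP.
move=> k; case: asboolP => // _; exact: fin_bigcap_measurable.
Qed.

(** The function is the pointwise limit of its compositions with roundings to
    finer and finer grids, each of which takes countably many values. *)
Lemma measurable_torus n (F : 'rV[C]_n -> C) : mcont F ->
  measurable_fun setT (fun t : n.-tuple (measurableTypeR R) =>
    cmod (F (torus_point t)) : R).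
Proof.
move=> cF.
pose D m (t : n.-tuple R) : n.-tuple R :=
  map_tuple (fun k : int => k%:~R / m.+1%:R)
    (map_tuple (fun x => Num.floor (x * m.+1%:R)) t).
apply: (@measurable_fun_cvg _ _ R setT
    (fun m t => cmod (F (torus_point (D m t))))) => [m|t _].
  apply: (@measurable_floor_tuple n m.+1%:R (fun k => cmod (F (torus_point
    (map_tuple (fun k : int => k%:~R / m.+1%:R) k))))).
  by rewrite ltr0n.
apply: cvg_cmod; apply/cvg_cmodP => e /(cF (torus_point t))[d d0 hd].
have Dt j : tnth (D m t) j @[m --> \oo] --> tnth t j.
  apply/cvgrPdist_lt => r r0.
  have := @cvg_harmonic R => /cvgrPdist_lt/(_ r r0).
  apply: filterS => m; rewrite sub0r normrN /harmonic ger0_norm ?invr_ge0 // => hm.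
  rewrite /D !tnth_map; have m0 : 0 < m.+1%:R :> R by rewrite ltr0n.
  have /andP[h1 h2] := floor_itv (tnth t j * m.+1%:R).
  set f : R := (Num.floor _)%:~R in h1 *.
  rewrite intrD -/f in h2.
  have -> : tnth t j - f / m.+1%:R = (tnth t j * m.+1%:R - f) / m.+1%:R.
    by rewrite mulrBl mulfK // lt0r_neq0.
  rewrite ger0_norm; last by rewrite divr_ge0 ?subr_ge0 // ltW.
  apply: le_lt_trans hm; rewrite -[leRHS]mul1r ler_pM2r ?invr_gt0 //; lra.
have : \forall m \near \oo, forall j, cmod (eit (tnth (D m t) j) - eit (tnth t j)) < d.
  apply: filter_forall => j; apply/(cvg_cmodP (fun m => eit (tnth (D m t) j)) _).1 => //.
  exact: (cvg_comp _ _ (Dt j) (@cvg_eit R _)).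
apply: filterS => m hm; apply: hd => j; rewrite !mxE; exact: hm.
Qed.

End TorusMeasurability.

Section PolydiscMean.
Context {R : realType}.
Local Notation C := R[i].
Local Notation U := (uniform_prob (@pi2_gt0 R)).

Definition upd n (w : 'rV[C]_n) (j : 'I_n) (a : C) : 'rV[C]_n :=
  \row_k if k == j then a else w 0 k.

(** Holomorphy in one variable is asked for whatever the other variables are, so
    that fixing some variables on the unit circle stays inside the class: this is
    what induction on the dimension needs. *)
Definition disc_alg n (F : 'rV[C]_n -> C) := [/\ mcont F,
  forall (w : 'rV[C]_n) j, cmod (w 0 j) < 1 ->
    cdiff (fun a => F (upd w j a)) (w 0 j) &
  exists B : R, forall w, cmod (F w) <= B].

Definition row_cons n (a : C) (w : 'rV[C]_n) : 'rV[C]_n.+1 :=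
  \row_j oapp (fun i => w 0 i) a (unlift ord0 j).

Lemma row_cons0 n a (w : 'rV[C]_n) : row_cons a w 0 ord0 = a.
Proof. by rewrite mxE unlift_none. Qed.

Lemma row_consS n a (w : 'rV[C]_n) j : row_cons a w 0 (lift ord0 j) = w 0 j.
Proof. by rewrite mxE liftK. Qed.

Lemma row_consP n (z : 'rV[C]_n.+1) :
  z = row_cons (z 0 ord0) (\row_j z 0 (lift ord0 j)).
Proof.
apply/rowP => j; case: (unliftP ord0 j) => [i ->|->].
  by rewrite row_consS mxE.
by rewrite row_cons0.
Qed.

Lemma row_cons_upd0 n a b (w : 'rV[C]_n) : row_cons b w = upd (row_cons a w) ord0 b.
Proof.
apply/rowP => j; rewrite [RHS]mxE; case: (unliftP ord0 j) => [i ->|->].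
  by rewrite !row_consS.
by rewrite eqxx row_cons0.
Qed.

Lemma row_cons_updS n a b (w : 'rV[C]_n) j :
  row_cons a (upd w j b) = upd (row_cons a w) (lift ord0 j) b.
Proof.
apply/rowP => k; rewrite [RHS]mxE; case: (unliftP ord0 k) => [i ->|->].
  by rewrite !row_consS (inj_eq lift_inj) mxE.
by rewrite !row_cons0.
Qed.

Lemma torus_point_cons n (t : R) (s : n.-tuple R) :
  torus_point (tuple_cons (t, s)) = row_cons (eit t) (torus_point s).
Proof.
apply/rowP => j; rewrite mxE; case: (unliftP ord0 j) => [i ->|->].
  by rewrite row_consS mxE /tuple_cons /= tnthS.
by rewrite row_cons0 /tuple_cons /= tnth0.
Qed.

Lemma disc_alg_tail n a (F : 'rV[C]_n.+1 -> C) : disc_alg F ->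
  disc_alg (fun w => F (row_cons a w)).
Proof.
move=> [cF dF [B FB]]; split; last by exists B.
- move=> w e /(cF (row_cons a w))[d d0 hd]; exists d => // y yw; apply: hd => j.
  case: (unliftP ord0 j) => [i ->|->]; first by rewrite !row_consS.
  by rewrite !row_cons0 subrr cmod0.
- move=> w j wj; have := dF (row_cons a w) (lift ord0 j).
  rewrite row_consS => /(_ wj); congr cdiff; apply/funext => b.
  by rewrite row_cons_updS.
Qed.

Lemma disc_alg_head n (w : 'rV[C]_n) (F : 'rV[C]_n.+1 -> C) : disc_alg F ->
  (forall a, ccont (fun a => F (row_cons a w)) a) /\
  (forall a, cmod a < 1 -> cdiff (fun a => F (row_cons a w)) a).
Proof.
move=> [cF dF _]; split=> [a e /(cF (row_cons a w))[d d0 hd]|a a1].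
  exists d => // y yw; apply: hd => j.
  case: (unliftP ord0 j) => [i ->|->]; last by rewrite !row_cons0.
  by rewrite !row_consS subrr cmod0.
have := dF (row_cons a w) ord0.
rewrite row_cons0 => /(_ a1); congr cdiff; apply/funext => b.
by rewrite -row_cons_upd0.
Qed.

(** K must not depend on F: the estimate is used for all powers of a function. *)
Lemma polydisc_mean n (z : 'rV[C]_n) : polydisc z -> exists2 K : R, 0 <= K &
  forall F, disc_alg F -> ((cmod (F z))%:E <=
    K%:E * \int[tuple_prob U n]_t (cmod (F (torus_point t)))%:E)%E.
Proof.
elim: n z => [|n IHn] z zD.
  exists 1 => // F [cF _ _]; rewrite mul1e /= integral_dirac //; last first.
    apply/measurable_EFinP; exact: (measurable_torus cF).
  rewrite diracT mul1e.
  by rewrite (_ : torus_point _ = z) //; apply/rowP => j; have := ltn_ord j.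
have [w1 wD] : cmod (z 0 ord0) < 1 /\ polydisc (\row_j z 0 (lift ord0 j)).
  split; first by rewrite -cmod_lt; exact: zD.
  by move=> j; rewrite mxE; exact: zD.
have [K K0 HK] := IHn _ wD.
have k0 : 0 <= 2 / (1 - cmod (z 0 ord0)) by rewrite divr_ge0 // subr_ge0 ltW.
exists (2 / (1 - cmod (z 0 ord0)) * K) => [|F hF]; first by rewrite mulr_ge0.
have [cF dF [B FB]] := hF.
have mF := measurable_torus cF.
rewrite /= ge0_integral_distribution; last 2 first.
- exact/measurable_EFinP.
- by move=> t; rewrite lee_fin cmod_ge0.
have mf : measurable_fun setT (fun x : measurableTypeR R * n.-tuple (measurableTypeR R) =>
    (cmod (F (torus_point (tuple_cons x))))%:E).
  apply/measurable_EFinP.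
  exact: (measurableT_comp mF (@measurable_tuple_cons _ (measurableTypeR R) n)).
rewrite fubini_tonelli1 //; last by move=> x; rewrite lee_fin cmod_ge0.
rewrite [z]row_consP row_cons0.
have [cH dH] := disc_alg_head (\row_j z 0 (lift ord0 j)) hF.
apply: le_trans (disc_mean cH dH (fun a => FB _) w1) _.
rewrite (EFinM (2 / _) K) -muleA; apply: lee_wpmul2l; first by rewrite lee_fin.
have mG : measurable_fun setT (fun t : measurableTypeR R => \int[tuple_prob U n]_s
    (cmod (F (torus_point (tuple_cons (t, s)))))%:E)%E.
  apply: (@measurable_fun_fubini_tonelli_F _ _ _ _ R (tuple_prob U n)
    (fun x : measurableTypeR R * n.-tuple (measurableTypeR R) =>
    (cmod (F (torus_point (tuple_cons x))))%:E)) => //.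
  by move=> x; rewrite lee_fin cmod_ge0.
rewrite -ge0_integralZl //.
- apply: ge0_le_integral => //.
  + by move=> t _; rewrite lee_fin cmod_ge0.
  + apply/measurable_EFinP; apply: continuous_measurable_fun => t.
    apply: cvg_cmod; apply: (ccont_path (E := fun a => F (row_cons a _))) => //.
    exact: cvg_eit.
  + exact: measurable_funeM.
  + move=> t _.
    have := HK _ (disc_alg_tail (eit t) hF).
    by under eq_integral do rewrite -torus_point_cons.
- by move=> t _; apply: integral_ge0 => s _; rewrite lee_fin cmod_ge0.
Qed.

End PolydiscMean.

(** * Bounded holomorphic functions and their radial limits *)

Section Clamp.
Context {R : realType}.
Local Notation C := R[i].

(** The radial retraction of C onto the closed unit disc. *)
Definition clamp (a : C) : C := (Num.max 1 (cmod a))^-1%:C * a.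

Lemma clampE a : cmod a <= 1 -> clamp a = a.
Proof. by move=> a1; rewrite /clamp max_l // invr1 mul1r. Qed.

Lemma cmod_clamp a : cmod (clamp a) <= 1.
Proof.
have m0 : 0 < Num.max 1 (cmod a) by rewrite lt_max ltr01.
rewrite cmodM cmod_real ger0_norm ?invr_ge0 ?(ltW m0) // mulrC ler_pdivrMr // mul1r.
by rewrite le_max lexx orbT.
Qed.

Lemma clamp_lipschitz a b : cmod (clamp a - clamp b) <= 2 * cmod (a - b).
Proof.
set m := Num.max 1 (cmod a); set n := Num.max 1 (cmod b).
have m1 : 1 <= m by rewrite le_max lexx.
have n1 : 1 <= n by rewrite le_max lexx.
have m0 : 0 < m by exact: lt_le_trans m1.
have n0 : 0 < n by exact: lt_le_trans n1.
have bn : cmod b <= n by rewrite le_max lexx orbT.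
have mn : `|n - m| <= cmod (a - b).
  have h1 := cmodD (a - b) b; have h2 := cmodD (b - a) a.
  rewrite subrK in h1; rewrite subrK cmodC in h2.
  have e1 : n <= m + cmod (a - b).
    rewrite /n ge_max; apply/andP; split; first by have := cmod_ge0 (a - b); lra.
    by apply: le_trans h2 _; rewrite addrC lerD2r /m le_max lexx orbT.
  have e2 : m <= n + cmod (a - b).
    rewrite /m ge_max; apply/andP; split; first by have := cmod_ge0 (a - b); lra.
    by apply: le_trans h1 _; rewrite addrC lerD2r /n le_max lexx orbT.
  by rewrite ler_norml; apply/andP; split; lra.
have -> : clamp a - clamp b = m^-1%:C * (a - b) + (m^-1 * ((n - m) * n^-1))%:C * b.
  have -> : m^-1 * ((n - m) * n^-1) = m^-1 - n^-1 by field; rewrite !lt0r_neq0.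
  by rewrite /clamp -/m -/n rmorphB /=; ring.
apply: le_trans (cmodD _ _) _; rewrite !cmodM !cmod_real.
have i1 : `|m^-1| <= 1 by rewrite ger0_norm ?invr_ge0 ?(ltW m0) // invf_le1.
rewrite !normrM (ger0_norm (_ : 0 <= n^-1)) ?invr_ge0 ?(ltW n0) //.
have i2 : n^-1 * cmod b <= 1 by rewrite mulrC ler_pdivrMr // mul1r.
rewrite mulr_natl mulr2n; apply: lerD.
  by rewrite ler_piMl // cmod_ge0.
have -> : `|m^-1| * (`|n - m| * n^-1) * cmod b =
  `|m^-1| * (`|n - m| * (n^-1 * cmod b)) by ring.
apply: le_trans (ler_piMl _ i1) _.
  by rewrite !mulr_ge0 ?invr_ge0 ?cmod_ge0 ?(ltW n0).
by apply: le_trans mn; rewrite ler_piMr.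
Qed.

Lemma ccontX k (x : C) : ccont (fun y => y ^+ k) x.
Proof.
elim: k => [|k IH].
  have -> : (fun y : C => y ^+ 0) = fun=> 1 by apply/funext => y; rewrite expr0.
  exact: ccont_cst.
have -> : (fun y : C => y ^+ k.+1) = fun y => y * y ^+ k.
  by apply/funext => y; rewrite exprS.
by apply: ccontM => //; exact: ccont_id.
Qed.

Lemma cdiffX k (f : C -> C) (x : C) : cdiff f x -> cdiff (fun y => f y ^+ k) x.
Proof.
move=> df; elim: k => [|k IH].
  have -> : (fun y : C => f y ^+ 0) = fun=> 1 by apply/funext => y; rewrite expr0.
  exact: cdiff_cst.
have -> : (fun y : C => f y ^+ k.+1) = fun y => f y * f y ^+ k.
  by apply/funext => y; rewrite exprS.
exact: cdiffM.
Qed.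

End Clamp.

Section Dilation.
Context {R : realType} {n : nat}.
Local Notation C := R[i].
Implicit Types (h : Hinf R n) (r : R).

(** The k-th power of the dilate w |-> h (r w), continued to all of C^n through
    the retraction so that it becomes a globally continuous function. *)
Definition dilate h r k (w : 'rV[C]_n) : C :=
  h (r%:C *: \row_j clamp (w 0 j)) ^+ k.

Lemma dilateE h r k (w : 'rV[C]_n) : (forall j, cmod (w 0 j) <= 1) ->
  dilate h r k w = h (r%:C *: w) ^+ k.
Proof.
move=> w1; rewrite /dilate; congr (Hinf_val h (_ *: _) ^+ _).
by apply/rowP => j; rewrite mxE clampE.
Qed.

Lemma polydiscE (w : 'rV[C]_n) : polydisc w <-> forall j, cmod (w 0 j) < 1.
Proof. by split=> wD j; have := wD j; rewrite (cmod_lt _ 1). Qed.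

Lemma dilate_polydisc r (w : 'rV[C]_n) : 0 <= r < 1 ->
  (forall j, cmod (w 0 j) <= 1) -> polydisc (r%:C *: w).
Proof.
move=> /andP[r0 r1] w1; apply/polydiscE => j; rewrite mxE cmodM cmod_real ger0_norm //.
by apply: le_lt_trans r1; rewrite ler_piMr.
Qed.

Lemma Hinf_mcont h (p : 'rV[C]_n) e : polydisc p -> 0 < e ->
  exists2 d : R, 0 < d & forall y : 'rV[C]_n, (forall j, cmod (y 0 j - p 0 j) < d) ->
    cmod (h y - h p) < e.
Proof.
move=> pD e0; have /differentiable_continuous ch := Hinf_holomorphic h pD.
have /(_ e e0) := (@cvg_cmodP _ _ (nbhs p) (nbhs_filter p) h (h p)).1 ch.
move=> /nbhs_ballP[[d di] /=]; rewrite ltcE /= => /andP[/eqP -> d0] hd.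
exists d => // y yp; apply: hd; split; first by rewrite ltcR.
by move=> i j; rewrite (ord1 i) -ball_normE /= distrC cmod_lt.
Qed.

Lemma Hinf_bound h : exists B : R, forall z, cmod (h z) <= B.
Proof.
exists (sup_norm polydisc h) => z.
have [zD|zD] := pselect (polydisc z).
  by rewrite -cmod_le; exact: sup_norm_ub (Hinf_bounded h) zD.
rewrite Hinf_out // cmod0; apply: sup_norm_ge0; first exact: polydisc_neq0.
exact: Hinf_bounded.
Qed.

Lemma Hinf_cdiff h (p : 'rV[C]_n) j : polydisc p ->
  cdiff (fun b => h (b *: delta_mx 0 j + p)) 0.
Proof.
move=> pD; apply: derivable_cdiff.
have := diff_derivable (v := delta_mx 0 j) (Hinf_holomorphic h pD).
rewrite /derivable; set D1 := (X in cvg (X @ _) -> _).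
set D2 := (X in _ -> cvg (X @ _)); suff -> : D2 = D1 by [].
apply/funext => b; rewrite /D1 /D2 /=.
have -> : b *: (1 : C) = b := mulr1 b.
by rewrite addr0 scale0r add0r.
Qed.

Lemma disc_alg_dilate h r k : 0 <= r < 1 -> disc_alg (dilate h r k).
Proof.
move=> r01; have /andP[r0 r1] := r01.
have cl1 (w : 'rV[C]_n) j : cmod ((\row_j clamp (w 0 j)) 0 j) <= 1.
  by rewrite mxE cmod_clamp.
split.
- move=> w e e0; have pD := dilate_polydisc r01 (cl1 w).
  have [e' e'0 he] := ccontX k (h (r%:C *: \row_j clamp (w 0 j))) e0.
  have [d d0 hd] := Hinf_mcont h pD e'0.
  exists (d / 2) => [|y yw]; first by rewrite divr_gt0.
  apply/he/hd => j; rewrite !mxE -mulrBr cmodM cmod_real ger0_norm //.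
  apply: (@le_lt_trans _ _ (cmod (clamp (y 0 j) - clamp (w 0 j)))).
    by rewrite ler_piMl ?cmod_ge0 // ltW.
  by apply: le_lt_trans (clamp_lipschitz _ _) _; have := yw j; lra.
- move=> w j wj; apply: cdiffX.
  have d0 : 0 < 1 - cmod (w 0 j) by rewrite subr_gt0.
  pose p := r%:C *: \row_j clamp (w 0 j).
  apply: (@cdiff_near _ (fun a => h ((r%:C * (a - w 0 j)) *: delta_mx 0 j + p)) _ _ _ d0).
    move=> a aw; congr (Hinf_val h _); apply/rowP => i; rewrite !mxE eqxx /=.
    have a1 : cmod a <= 1 by have := cmodD (a - w 0 j) (w 0 j); rewrite subrK; lra.
    case: eqP => [->|_]; last by rewrite mulr0 add0r.
    by rewrite !clampE ?(ltW wj) // mulr1; ring.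
  apply: (@cdiff_comp _ (fun a => r%:C * (a - w 0 j))
    (fun b => h (b *: delta_mx 0 j + p))).
    exists (fun=> r%:C); first exact: ccont_cst.
    by move=> y; ring.
  rewrite subrr mulr0; apply: Hinf_cdiff; exact: dilate_polydisc (cl1 w).
- have [B hB] := Hinf_bound h; exists (B ^+ k) => w.
  by rewrite /dilate cmodX lerXn2r ?nnegrE ?cmod_ge0 // (le_trans _ (hB 0)) ?cmod_ge0.
Qed.

End Dilation.

Section BoundaryMaximum.
Context {R : realType} {n : nat}.
Local Notation C := R[i].
Local Notation mu := (tuple_prob (uniform_prob (@pi2_gt0 R)) n).
Implicit Types (f h : Hinf R n).

Lemma power_bound (a M K : R) : 0 <= M -> 0 <= K ->
  (forall k, a ^+ k <= K * M ^+ k) -> a <= M.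
Proof.
move=> M0 K0 aM; rewrite leNgt; apply/negP => Ma.
have a0 : 0 < a by exact: le_lt_trans Ma.
have q1 : `|M / a| < 1.
  by rewrite ger0_norm ?divr_ge0 ?(ltW a0) // ltr_pdivrMr // mul1r.
have K1 : 0 < K + 1 by rewrite ltr_wpDl.
have e0 : 0 < (K + 1)^-1 by rewrite invr_gt0.
have := cvg_expr q1; move=> /cvgrPdist_lt/(_ _ e0)[k _ hk].
have := hk k (leqnn k); rewrite sub0r normrN expr_div_n ger0_norm; last first.
  by rewrite divr_ge0 // exprn_ge0 // ltW.
have ak : 0 < a ^+ k by rewrite exprn_gt0.
rewrite ltr_pdivrMr // mulrC ltr_pdivlMr // => h.
have := aM k; have := exprn_ge0 k M0; nra.
Qed.

Definition radius (m : nat) : R := 1 - m.+1%:R^-1.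

Lemma radius_itv m : 0 <= radius m < 1.
Proof.
rewrite /radius subr_ge0 invf_le1 ?ltr0n // ler1n /=.
by rewrite ltrBlDr ltrDl invr_gt0 ltr0n.
Qed.

Lemma radius_cvg : radius m @[m --> \oo] --> (1 : R).
Proof.
rewrite -[X in _ --> X]subr0; apply: cvgB; first exact: cvg_cst.
exact: cvg_harmonic.
Qed.

Lemma near_radius (P : R -> Prop) :
  (\forall r \near 1^'-, P r) -> \forall m \near \oo, P (radius m).
Proof.
rewrite near_withinE => HP.
have : \forall m \near \oo, radius m < 1 -> P (radius m) by exact: radius_cvg HP.
by apply: filterS => m; apply; have /andP[] := radius_itv m.
Qed.

Lemma Hinf_radial_cvg h z : polydisc z ->
  cmod (h ((radius m)%:C *: z)) @[m --> \oo] --> cmod (h z).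
Proof.
move=> zD; apply: cvg_cmod; apply/cvg_cmodP => e /(Hinf_mcont h zD)[d d0 hd].
have := radius_cvg => /cvgrPdistC_lt/(_ d d0); apply: filterS => m rd.
apply: hd => j; rewrite mxE; apply: le_lt_trans rd.
have -> : (radius m)%:C * z 0 j - z 0 j = (radius m - 1)%:C * z 0 j.
  by rewrite (rmorphB _ (radius m) 1) rmorph1 mulrBl mul1r.
rewrite cmodM cmod_real ler_piMr //; apply: ltW.
exact: (polydiscE z).1.
Qed.

(** The integral means of |h(r .)|^k control |h|^k with a constant that does not
    depend on k; dominated convergence and then k-th roots remove it. *)
Lemma boundary_maximum h (M : R) : 0 <= M ->
  {ae mu, forall t, \forall r \near 1^'-,
    cmod (h (r%:C *: torus_point t)) <= M} ->
  forall z, polydisc z -> cmod (h z) <= M.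
Proof.
move=> M0 hM z zD; have [K K0 HK] := polydisc_mean zD.
have [B hB] := Hinf_bound h.
have z1 j : cmod (z 0 j) <= 1 by exact/ltW/(polydiscE z).1.
have t1 (t : n.-tuple R) j : cmod (torus_point t 0 j) <= 1.
  by rewrite mxE -[X in cmod X]/(eit (tnth t j)) cmod_eit.
apply: (power_bound M0 K0) => k.
(* The powers are only known to be eventually at most M^k; their maximum with
   M^k converges to M^k. *)
pose g m (t : n.-tuple (measurableTypeR R)) : R :=
  Num.max (cmod (dilate h (radius m) k (torus_point t))) (M ^+ k).
have mg m : measurable_fun setT (g m).
  apply: measurable_maxr => //; apply: measurable_torus.
  by have [] := disc_alg_dilate h k (radius_itv m).
have B0 : 0 <= B by exact: le_trans (cmod_ge0 _) (hB 0).
have gB m t : `|g m t| <= B ^+ k + M ^+ k.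
  rewrite ger0_norm; last by rewrite le_max cmod_ge0.
  have Bk : 0 <= B ^+ k by rewrite exprn_ge0.
  have Mk : 0 <= M ^+ k by rewrite exprn_ge0.
  rewrite ge_max; apply/andP; split; last by lra.
  have : cmod (dilate h (radius m) k (torus_point t)) <= B ^+ k.
    by rewrite cmodX lerXn2r ?nnegrE ?cmod_ge0.
  by lra.
have lim : (\int[mu]_t (g m t)%:E)%E @[m --> \oo] --> (M ^+ k)%:E.
  have H1 m : measurable_fun setT (fun t => (g m t)%:E) by exact/measurable_EFinP.
  have H3 : {ae mu, forall t, [set: n.-tuple (measurableTypeR R)] t ->
      (g m t)%:E @[m --> \oo] --> (M ^+ k)%:E}.
    have [A [mA A0 sA]] := hM; exists A; split=> // t /= nt; apply: sA => /= ht.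
    move: ht => /near_radius ht; apply: nt => _; apply: cvg_near_cst.
    apply: filterS ht => m hm; congr _%:E; rewrite /g max_r //.
    by rewrite dilateE // cmodX lerXn2r ?nnegrE ?cmod_ge0.
  have H4 : mu.-integrable setT (fun=> (B ^+ k + M ^+ k)%:E).
    exact: finite_measure_integrable_cst.
  have H5 : {ae mu, forall t m, [set: n.-tuple (measurableTypeR R)] t ->
      (`|(g m t)%:E| <= (B ^+ k + M ^+ k)%:E)%E}.
    by apply: aeW => t m _; rewrite lee_fin.
  have [_ _] := dominated_convergence measurableT H1
    (@measurable_cst _ _ _ _ _ _) H3 H4 H5.
  by rewrite integral_cst //= probability_setT mule1.
have le m : (((cmod (h ((radius m)%:C *: z)) ^+ k))%:E <= K%:E * \int[mu]_t (g m t)%:E)%E.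
  have := HK _ (disc_alg_dilate h k (radius_itv m)).
  rewrite dilateE // cmodX => /le_trans; apply.
  apply: lee_wpmul2l; first by rewrite lee_fin.
  apply: ge0_le_integral => //.
  - by move=> t _; rewrite lee_fin cmod_ge0.
  - apply/measurable_EFinP; apply: measurable_torus.
    by have [] := disc_alg_dilate h k (radius_itv m).
  - exact/measurable_EFinP.
  - by move=> t _; rewrite lee_fin le_max lexx.
have l1 : (cmod (h ((radius m)%:C *: z)) ^+ k)%:E @[m --> \oo] -->
    (cmod (h z) ^+ k)%:E.
  apply: cvg_EFin; first exact: nearW.
  have := cvg_comp _ _ (@Hinf_radial_cvg h z zD) (@exprn_continuous R k (cmod (h z))).
  by [].
have l2 : (K%:E * \int[mu]_t (g m t)%:E)%E @[m --> \oo] --> (K%:E * (M ^+ k)%:E)%E.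
  exact: cvgeZl.
rewrite -lee_fin EFinM -(cvg_lim _ l1) // -(cvg_lim _ l2) //.
by apply: lee_lim; [exact: cvgP l1|exact: cvgP l2|exact: nearW].
Qed.

End BoundaryMaximum.

Section Assembly.
Context {R : realType} {n : nat}.
Local Notation C := R[i].

Lemma near_left1_itv : \forall r \near (1 : R)^'-, 0 <= r < 1.
Proof.
near=> r; apply/andP; split; last by near: r; exact: nbhs_left_lt.
by near: r; apply: nbhs_left_ge; exact: ltr01.
Unshelve. all: by end_near. Qed.

Lemma radial_eventually (f : Hinf R n) (delta : R) (t : n.-tuple R) :
  cvg (radial f (torus_point t) r @[r --> 1^'-]) ->
  delta%:C < `|radial_limit f (torus_point t)| ->
  \forall r \near 1^'-, polydisc (r%:C *: torus_point t) /\
    delta <= cmod (f (r%:C *: torus_point t)).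
Proof.
move=> cf; rewrite -cmodE ltcR => df.
have cm : cmod (radial f (torus_point t) r) @[r --> 1^'-] -->
    cmod (radial_limit f (torus_point t)) by exact: cvg_cmod cf.
have big : \forall r \near 1^'-, delta < cmod (radial f (torus_point t) r).
  exact: cvgr_gt cm _ df.
apply: filterS2 near_left1_itv big => r r01 /ltW dr; split=> //.
apply: dilate_polydisc r01 _ => j.
by rewrite mxE -[X in cmod X]/(eit (tnth t j)) cmod_eit.
Qed.

End Assembly.

Theorem theorem5p1 (R : realType) (n : nat) (hn : (1 <= n)%N)
  (J : set (Hinf R n)) (hJ : M_ideal J)
  (J_proper : J <> setT) (J_nontrivial : J <> [set 0]) :
  analytic_prime J.
Proof.
split=> //; first exact: hJ.1.
move=> f g Jfg [delta d0 fd].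
pose A := [set z : 'rV[R[i]]_n | polydisc z /\ delta <= cmod (f z)].
have [N [mN N0 sN]] := fd.
have inA t : ~ N t -> \forall r \near 1^'-, A (r%:C *: torus_point t).
  move=> Nt; have [cf df] : cvg (radial f (torus_point t) r @[r --> 1^'-]) /\
      delta%:C < `|radial_limit f (torus_point t)|.
    by apply: contrapT => h; apply: Nt; apply: sN.
  exact: radial_eventually cf df.
(* A null set is not the whole torus, so some radius ends in A *)
have A0 : A !=set0.
  have [t Nt] : exists t, ~ N t.
    apply: contrapT => /forallNP h.
    have NT : N = setT by apply/seteqP; split=> // t _; apply: contrapT; exact: h.
    by move: N0; rewrite NT probability_setT => /eqP; rewrite onee_eq0.
  have [r Ar] := filter_ex (inA t Nt).
  by exists (r%:C *: torus_point t).
apply: (@M_ideal_cancel R n J f g A delta hJ A0 _ d0 _ _ Jfg) => [z []//|z []//|h M hM].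
apply: boundary_maximum.
  by have [z Az] := A0; exact: le_trans (cmod_ge0 _) (hM z Az).
exists N; split=> // t /= ht; apply: contrapT => Nt; apply: ht.
by apply: filterS (inA t Nt) => r; exact: hM.
Qed.
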